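(* Let $T_3,T_4,T_6\in\mathbb{R}$ and consider a left-invariant sub-Riemannian Engel structure on a Lie group $G$ whose Lie algebra has a basis $X_1,X_2,X_3,X_4$ with $$\begin{aligned} &[X_1,X_2]=X_3, &&[X_1,X_3]=X_4,\\ &[X_1,X_4]=T_3X_3, &&[X_2,X_3]=T_6X_1+T_4X_2,\\ &[X_2,X_4]=T_4X_3, &&[X_3,X_4]=-T_6T_3X_1-T_4T_3X_2+T_4X_4, \end{aligned}$$ where the left-invariant vector fields $X_1,X_2$ form an orthonormal sub-Riemannian frame. Then the normal Hamiltonian flow of this structure on $T^*G$, i.e. the flow with Hamiltonian $H=\frac12(h_1^2+h_2^2)$, is super-integrable, meaning that it has four independent pairwise Poisson-commuting first integrals including the Hamiltonian $H$, and one more first integral, independent of these four, that commutes with $H$. If $T_4\neq0$, then the abnormal geodesics of the structure are strictly abnormal.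
   Context: The distribution is $\mathcal{D}=\mathrm{span}\{X_1,X_2\}$ with the metric making $X_1,X_2$ orthonormal; $h_i(\lambda)=\langle\lambda,X_i\rangle$ for $\lambda\in T^*G$. Poisson brackets are those of the canonical symplectic structure on $T^*G$. Functions on $T^*G$ are independent if their differentials are linearly independent almost everywhere on $T^*G$. An admissible curve is a Lipschitz curve $q$ on a compact interval with $\dot q=u_1X_1(q)+u_2X_2(q)$ a.e., $u_1,u_2\in L^\infty$; its length is $\int\sqrt{u_1^2+u_2^2}\,dt$. A geodesic is an admissible curve of (nonzero) constant speed whose sufficiently small arcs are length minimizers. For $u\in\mathbb{R}^2$, $\nu\le0$ let $H_u(\lambda,\nu)=u_1h_1+u_2h_2+\frac{\nu}{2}(u_1^2+u_2^2)$. A curve $q$ with control $\tilde u$ satisfies the Pontryagin maximum principle with a Lipschitz curve $\lambda(t)\in T^*_{q(t)}G$ (an extremal) and $\nu\le0$ if: (1) $(\lambda(t),\nu)\neq0$; (2) $\dot\lambda(t)=\vec H_{\tilde u(t)}(\lambda(t))$, with $\vec H$ the Hamiltonian vector field; (3) $H_{\tilde u(t)}(\lambda(t),\nu)=\max_{u\in\mathbb{R}^2}H_u(\lambda(t),\nu)$ (a.e. $t$). The extremal is abnormal if this holds with $\nu=0$ and normal if it holds with $\nu<0$. A geodesic is abnormal if it is the projection of an abnormal extremal; it is strictly abnormal if in addition it is not the projection of any normal extremal. *)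

(* Defs.v *)
From HB Require Import structures.
From mathcomp Require Import all_boot all_order all_algebra.
From mathcomp Require Import all_classical all_reals all_analysis.

Set Implicit Arguments.
Unset Strict Implicit.
Unset Printing Implicit Defensive.

Import Order.TTheory GRing.Theory Num.Theory.
Import numFieldNormedType.Exports.

Local Open Scope classical_set_scope.
Local Open Scope ring_scope.

(* C^infinity on the open set U: every iterated directional derivative is
   (Frechet) differentiable at every point of U. *)
Definition smooth_on (R : realType) (m : nat) (W : normedModType R)
    (U : set 'rV[R]_m) (f : 'rV[R]_m -> W) : Prop :=
  forall (vs : seq 'rV[R]_m) (x : 'rV[R]_m), U x ->
    differentiable (foldr (fun v (g : 'rV[R]_m -> W) => 'D_v g) f vs) x.

(* Lebesgue-null subsets of R^m: for every e > 0 there is a cover by countably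
   many closed boxes of total volume at most e. *)
Definition null_set (R : realType) (m : nat) (A : set 'rV[R]_m) : Prop :=
  forall e : R, 0 < e ->
    exists lo hi : nat -> 'rV[R]_m,
      [/\ forall k l, lo k 0 l <= hi k 0 l,
          A `<=` \bigcup_k [set x | forall l, lo k 0 l <= x 0 l <= hi k 0 l]
        & forall N, \sum_(k < N) \prod_(l < m) (hi k 0 l - lo k 0 l) <= e].

(* Charts [chart i], defined on [dom i] with inverse [param i] (both extended
   arbitrarily to total functions), and a preferred chart at each point.

   A tangent vector or covector at q is represented by the row of its
   components in the preferred chart [chart_at q]; components in other charts
   are obtained with the Jacobian of the change of coordinates.  Recall that
   for [jacobian f x] rows are indexed by the source variables, so that vectors
   v are transported as v *m J and covectors are pulled back as a *m J^T. *)
Record atlas (R : realType) (m : nat) (P : Type) := Atlas {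
  chart_index : Type;
  chart_at : P -> chart_index;
  dom : chart_index -> set P;
  chart : chart_index -> P -> 'rV[R]_m;
  param : chart_index -> 'rV[R]_m -> P }.

Section ChartCalculus.
Context {R : realType} {m : nat} {P : Type}.
Variable A : atlas R m P.

Definition chart_range (i : chart_index A) : set 'rV[R]_m := chart i @` dom i.

Definition smooth_fun (F : P -> R) : Prop :=
  forall i : chart_index A, smooth_on (chart_range i) (F \o param i : _ -> R^o).

Definition differential (F : P -> R) (p : P) : 'rV[R]_m :=
  \row_l 'D_(delta_mx 0 l) (F \o param (chart_at A p) : _ -> R^o)
           (chart (chart_at A p) p).

Definition velocity (gam : R -> P) (t : R) (v : 'rV[R]_m) : Prop :=
  (\forall s \near t, dom (chart_at A (gam t)) (gam s)) /\
  is_derive (t : R^o) 1 (chart (chart_at A (gam t)) \o gam) v.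

Definition lipschitz_curve (a b : R) (gam : R -> P) : Prop :=
  forall t, t \in `[a, b] ->
    exists e L : R, 0 < e /\
      forall s s' : R, s \in `[a, b] -> s' \in `[a, b] ->
        `|s - t| < e -> `|s' - t| < e ->
        dom (chart_at A (gam t)) (gam s) /\
        `|chart (chart_at A (gam t)) (gam s) -
          chart (chart_at A (gam t)) (gam s')| <= L * `|s - s'|.

Definition null_in_charts (N : set P) : Prop :=
  forall i : chart_index A, null_set (chart i @` (N `&` dom i)).

Definition independent (k : nat) (F : k.-tuple (P -> R)) : Prop :=
  null_in_charts
    [set p | ~~ row_free (\matrix_(j < k) differential (tnth F j) p)].

End ChartCalculus.

Record is_manifold (R : realType) (n : nat) (M : topologicalType)
    (A : atlas R n M) : Prop := IsManifold {
  manifold_hausdorff : hausdorff_space M;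
  manifold_countable : @second_countable M;
  chart_at_dom : forall q, dom (chart_at A q) q;
  dom_open : forall i : chart_index A, open (dom i);
  range_open : forall i : chart_index A, open (chart_range i);
  chartK : forall (i : chart_index A) q, dom i q -> param i (chart i q) = q;
  chart_continuous : forall (i : chart_index A) q, dom i q ->
    {for q, continuous (chart i)};
  param_continuous : forall (i : chart_index A) x, chart_range i x ->
    {for x, continuous (param i)};
  transition_smooth : forall i j : chart_index A,
    smooth_on (chart i @` (dom i `&` dom j)) (chart j \o param i) }.

Record is_lie_group (R : realType) (n : nat) (G : topologicalType)
    (A : atlas R n G) (mul : G -> G -> G) (one : G) (inv : G -> G) : Prop :=
  IsLieGroup {
  lie_manifold : is_manifold A;
  lie_mulA : associative mul;
  lie_mul1 : left_id one mul;
  lie_mulV : left_inverse one inv mul;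
  lie_mul_continuous : continuous (fun z : G * G => mul z.1 z.2);
  lie_inv_continuous : continuous inv;
  lie_mul_smooth : forall i j k : chart_index A,
    smooth_on
      [set z : 'rV[R]_(n + n) |
        [/\ chart_range i (lsubmx z), chart_range j (rsubmx z)
          & dom k (mul (param i (lsubmx z)) (param j (rsubmx z)))]]
      (fun z => chart k (mul (param i (lsubmx z)) (param j (rsubmx z))));
  lie_inv_smooth : forall i j : chart_index A,
    smooth_on [set x | chart_range i x /\ dom j (inv (param i x))]
      (fun x => chart j (inv (param i x))) }.

Record lieGroup (R : realType) (n : nat) := LieGroup {
  lie_sort :> topologicalType;
  lie_atlas : atlas R n lie_sort;
  lie_mul : lie_sort -> lie_sort -> lie_sort;
  lie_one : lie_sort;
  lie_inv : lie_sort -> lie_sort;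
  lie_groupP : is_lie_group lie_atlas lie_mul lie_one lie_inv }.

Section VectorFields.
Context {R : realType} {n : nat} {M : Type}.
Variable A : atlas R n M.

Definition field_in (i : chart_index A) (X : M -> 'rV[R]_n) (x : 'rV[R]_n)
    : 'rV[R]_n :=
  let q := param i x in
  X q *m jacobian (chart i \o param (chart_at A q)) (chart (chart_at A q) q).

Definition smooth_field (X : M -> 'rV[R]_n) : Prop :=
  forall i : chart_index A, smooth_on (chart_range i) (field_in i X).

Definition field_bracket (X Y : M -> 'rV[R]_n) (q : M) : 'rV[R]_n :=
  let i := chart_at A q in
  let x := chart i q in
  'D_(field_in i X x) (field_in i Y) x - 'D_(field_in i Y x) (field_in i X) x.

(* The cotangent bundle, with the charts (x, p) for which the covector is
   sum_k p_k dx_k. *)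
Definition cotangent : Type := (M * 'rV[R]_n)%type.

Definition cotangent_atlas : atlas R (n + n) cotangent :=
  {| chart_index := chart_index A;
     chart_at := fun lam => chart_at A lam.1;
     dom := fun i => [set lam | dom i lam.1];
     chart := fun i lam =>
       row_mx (chart i lam.1)
         (lam.2 *m (jacobian (chart (chart_at A lam.1) \o param i)
                             (chart i lam.1))^T);
     param := fun i z =>
       let q := param i (lsubmx z) in
       (q, rsubmx z *m (jacobian (chart i \o param (chart_at A q))
                                 (chart (chart_at A q) q))^T) |}.

(* Canonical symplectic structure sum_k dp_k /\ dx_k: the Hamiltonian field is
   x' = dF/dp, p' = - dF/dx, and {F, K} is the derivative of K along it. *)
Definition hamiltonian_field (F : cotangent -> R) (lam : cotangent)
    : 'rV[R]_(n + n) :=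
  row_mx (rsubmx (differential cotangent_atlas F lam))
         (- lsubmx (differential cotangent_atlas F lam)).

Definition poisson (F K : cotangent -> R) (lam : cotangent) : R :=
  (hamiltonian_field F lam *m (differential cotangent_atlas K lam)^T) 0 0.

Definition poisson_commute (F K : cotangent -> R) : Prop :=
  forall lam, poisson F K lam = 0.

Definition first_integral (H F : cotangent -> R) : Prop :=
  smooth_fun cotangent_atlas F /\
  forall (a b : R) (lam : R -> cotangent),
    (forall t, t \in `]a, b[ ->
       velocity cotangent_atlas lam t (hamiltonian_field H (lam t))) ->
    forall s t, s \in `]a, b[ -> t \in `]a, b[ -> F (lam s) = F (lam t).

(* <lam, X> *)
Definition pairing (X : M -> 'rV[R]_n) (lam : cotangent) : R :=
  (lam.2 *m (X lam.1)^T) 0 0.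

End VectorFields.

Arguments cotangent R n M : clear implicits.

Definition super_integrable (R : realType) (M : Type) (A : atlas R 4 M)
    (H : cotangent R 4 M -> R) : Prop :=
  exists F2 F3 F4 K : cotangent R 4 M -> R,
    [/\ forall j, first_integral A H (tnth [tuple H; F2; F3; F4] j),
        forall j k, poisson_commute A (tnth [tuple H; F2; F3; F4] j)
                                      (tnth [tuple H; F2; F3; F4] k),
        independent (cotangent_atlas A) [tuple H; F2; F3; F4]
      & [/\ first_integral A H K, poisson_commute A K H
          & independent (cotangent_atlas A) [tuple H; F2; F3; F4; K]]].

Section LieAlgebra.
Context {R : realType} {n : nat}.
Variable G : lieGroup R n.
Let A := lie_atlas G.

Definition left_invariant (X : G -> 'rV[R]_n) : Prop :=
  smooth_field A X /\
  forall g q : G,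
    X (lie_mul g q) =
    X q *m jacobian (chart (chart_at A (lie_mul g q)) \o lie_mul g
                       \o param (chart_at A q))
                    (chart (chart_at A q) q).

(* The Lie algebra of G is the space of left-invariant vector fields. *)
Definition lie_basis (d : nat) (X : d.-tuple (G -> 'rV[R]_n)) : Prop :=
  [/\ forall j, left_invariant (tnth X j),
      forall c : 'I_d -> R,
        (forall q, \sum_j c j *: tnth X j q = 0) -> forall j, c j = 0
    & forall Y, left_invariant Y ->
        exists c : 'I_d -> R, forall q, Y q = \sum_j c j *: tnth X j q].

End LieAlgebra.

Section SubRiemannian.
(* The sub-Riemannian structure with orthonormal frame X1, X2. *)
Context {R : realType} {n : nat} {M : Type}.
Variables (A : atlas R n M) (X1 X2 : M -> 'rV[R]_n).

Definition speed (u : R -> R * R) (t : R) : R :=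
  Num.sqrt ((u t).1 ^+ 2 + (u t).2 ^+ 2).

Definition normal_hamiltonian (lam : cotangent R n M) : R :=
  ((pairing X1 lam) ^+ 2 + (pairing X2 lam) ^+ 2) / 2.

Definition admissible (a b : R) (q : R -> M) (u : R -> R * R) : Prop :=
  [/\ a < b, lipschitz_curve A a b q,
      measurable_fun `[a, b] (fst \o u) /\ measurable_fun `[a, b] (snd \o u),
      exists C : R, {ae (@lebesgue_measure R), forall t, t \in `[a, b] ->
        `|(u t).1| <= C /\ `|(u t).2| <= C}
    & {ae (@lebesgue_measure R), forall t, t \in `[a, b] ->
        velocity A q t ((u t).1 *: X1 (q t) + (u t).2 *: X2 (q t))}].

Definition curve_length (a b : R) (u : R -> R * R) : \bar R :=
  (\int[@lebesgue_measure R]_(t in `[a, b]) (speed u t)%:E)%E.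

Definition length_minimizer (a b : R) (q : R -> M) : Prop :=
  exists2 u, admissible a b q u &
    forall c d p w, admissible c d p w -> p c = q a -> p d = q b ->
      (curve_length a b u <= curve_length c d w)%E.

Definition geodesic (a b : R) (q : R -> M) : Prop :=
  (exists u, admissible a b q u /\
     exists2 c : R, 0 < c & {ae (@lebesgue_measure R), forall t,
       t \in `[a, b] -> speed u t = c}) /\
  exists2 del : R, 0 < del & forall s s' : R,
    a <= s -> s < s' -> s' <= b -> s' - s < del -> length_minimizer s s' q.

Definition control_hamiltonian (w : R * R) (nu : R) (lam : cotangent R n M)
    : R :=
  w.1 * pairing X1 lam + w.2 * pairing X2 lam
  + nu / 2 * (w.1 ^+ 2 + w.2 ^+ 2).

(* q with control u satisfies the Pontryagin maximum principle with (lam, nu) *)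
Definition pontryagin (a b : R) (q : R -> M) (u : R -> R * R)
    (lam : R -> cotangent R n M) (nu : R) : Prop :=
  [/\ nu <= 0, lipschitz_curve (cotangent_atlas A) a b lam,
      forall t, t \in `[a, b] ->
        (lam t).1 = q t /\ ((lam t).2 != 0 \/ nu != 0),
      {ae (@lebesgue_measure R), forall t, t \in `[a, b] ->
        velocity (cotangent_atlas A) lam t
          (hamiltonian_field A (control_hamiltonian (u t) nu) (lam t))}
    & {ae (@lebesgue_measure R), forall t, t \in `[a, b] -> forall w : R * R,
        control_hamiltonian w nu (lam t)
          <= control_hamiltonian (u t) nu (lam t)}].

Definition abnormal_geodesic (a b : R) (q : R -> M) : Prop :=
  geodesic a b q /\
  exists u lam, admissible a b q u /\ pontryagin a b q u lam 0.

Definition strictly_abnormal_geodesic (a b : R) (q : R -> M) : Prop :=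
  abnormal_geodesic a b q /\
  ~ exists u lam nu,
      [/\ admissible a b q u, nu < 0 & pontryagin a b q u lam nu].

End SubRiemannian.

(* Main.v *)
Require Import Defs.
From HB Require Import structures.
From mathcomp Require Import all_boot all_order all_algebra.
From mathcomp Require Import all_classical all_reals all_analysis.
From mathcomp Require Import ring lra.

(* Write h_i for the pairing of a covector with X_i; in canonical coordinates
   {h_X, h_Y} = h_[X, Y].

   The Lie algebra has the central element X4 + T4 X1 - T3 X2, and its quotient
   by it is three-dimensional and unimodular; this gives a linear Casimir C1 and
   a quadratic one C2.  The push-forward Y_j of X_j by inversion is
   right-invariant, hence commutes with every X_i, and [Y1, Y3] = Y4.  So H, C1,
   C2, h_Y1 commute pairwise and h_Y3 commutes with H.  In a linear relation
   between the five differentials, pairing with h_Y1 and h_Y3 kills the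
   coefficients of h_Y1 and h_Y3 where h_Y4 <> 0, and the vertical parts kill the
   other three where h1 and h3 do not vanish.  The zero set of the pairing with a
   nowhere vanishing field is null: over a fine grid in the other coordinates it
   lies in thin slabs.

   Along an abnormal extremal h1 = h2 = 0, then h3 = 0 and u1 h4 = 0, and
   h4 <> 0, so u1 = 0 and u2 <> 0.  If a normal extremal had the same control,
   it would satisfy h1 = 0, hence h3 = 0, hence T4 u2 h2 = 0 with h2 a nonzero
   multiple of u2, which forces T4 = 0. *)

Set Implicit Arguments.
Unset Strict Implicit.
Unset Printing Implicit Defensive.

Import Order.TTheory GRing.Theory Num.Theory.
Import numFieldNormedType.Exports.
(* MathComp-Analysis also defines a [null_set]. *)
Import Defs.

Local Open Scope classical_set_scope.
Local Open Scope ring_scope.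

(** * Smooth functions *)

(** Manifolds are given by charts, with vectors and covectors stored in a preferred chart at each
    point. Changes of coordinates are handled as tangent maps of the identity, and invariance of a
    field becomes relatedness of coordinate fields under a smooth map. One computation with second
    derivatives then yields both bracket facts: inversion preserves brackets, and multiplication
    relates the two kinds of invariant fields to fields living on separate factors of the product,
    which commute.

    On an eight-dimensional phase space at most four independent functions can commute pairwise, so
    h_Y3 has to stand apart. Since dH, dC1 and dC2 lie in the span of the differentials of the h_i,
    they pair to zero with every right-invariant integral; the rest is linear algebra at one
    covector.

    Controls are only measurable and extremals only Lipschitz. An identity such as h1 = 0 first
    holds almost everywhere; continuity extends it to the open interval, and then it is
    differentiated at almost every time. The geodesic, abnormal and normal conditions each come with
    a control of their own; these agree almost everywhere. *)

Section Calculus.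
Context {R : realType}.

Lemma derive_row_mxr m n (W : normedModType R) (f : 'rV[R]_(m + n) -> W)
    (a : 'rV[R]_m) (b : 'rV[R]_n) v :
  'D_v (fun y => f (row_mx a y)) b = 'D_(row_mx 0 v) f (row_mx a b).
Proof.
rewrite /derive; set F := (fun h : R => _); set F' := (fun h : R => _).
suff -> : F = F' by []; apply/funext => h; rewrite /F /F'.
have E : h *: row_mx 0 v + row_mx a b = row_mx a (h *: v + b).
  by rewrite scale_row_mx scaler0 add_row_mx add0r.
by rewrite /= E.
Qed.

Lemma derive_row_mxl m n (W : normedModType R) (f : 'rV[R]_(m + n) -> W)
    (a : 'rV[R]_m) (b : 'rV[R]_n) v :
  'D_v (fun y => f (row_mx y b)) a = 'D_(row_mx v 0) f (row_mx a b).
Proof.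
rewrite /derive; set F := (fun h : R => _); set F' := (fun h : R => _).
suff -> : F = F' by []; apply/funext => h; rewrite /F /F'.
have E : h *: row_mx v 0 + row_mx a b = row_mx (h *: v + a) b.
  by rewrite scale_row_mx scaler0 add_row_mx add0r.
by rewrite /= E.
Qed.

Lemma derive_lsubmx m n (W : normedModType R) (f : 'rV[R]_m -> W)
    (z : 'rV[R]_(m + n)) v :
  'D_v (fun z => f (lsubmx z)) z = 'D_(lsubmx v) f (lsubmx z).
Proof.
rewrite /derive; set F := (fun h : R => _); set F' := (fun h : R => _).
suff -> : F = F' by []; apply/funext => h; rewrite /F /F'.
have E : lsubmx (h *: v + z) = h *: lsubmx v + lsubmx z.
  by apply/rowP => k; rewrite !mxE.
by rewrite /= E.
Qed.

Lemma derive_rsubmx m n (W : normedModType R) (f : 'rV[R]_n -> W)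
    (z : 'rV[R]_(m + n)) v :
  'D_v (fun z => f (rsubmx z)) z = 'D_(rsubmx v) f (rsubmx z).
Proof.
rewrite /derive; set F := (fun h : R => _); set F' := (fun h : R => _).
suff -> : F = F' by []; apply/funext => h; rewrite /F /F'.
have E : rsubmx (h *: v + z) = h *: rsubmx v + rsubmx z.
  by apply/rowP => k; rewrite !mxE.
by rewrite /= E.
Qed.

(* Unfolding these makes failing unification problems explode. *)
#[local] Opaque jacobian derive diff.

(** The little-o expansion of [f] at [x] is also one for [g], and [diff_unique] recognises its
    linear part as the differential. *)
Lemma near_eq_differentiable (V W : normedModType R) (f g : V -> W) (x : V) :
  (\forall y \near x, f y = g y) -> differentiable f x -> differentiable g x.
Proof.
move=> fg /diff_locallyP [dfc dfx].
have fgx : f x = g x := nbhs_singleton fg.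
have H : g \o shift x = cst (g x) + 'd f x +o_ 0 id.
  apply/eqaddoE; apply/eqaddoP => e e0.
  have /eqaddoP/(_ e e0) H := dfx.
  move: fg; rewrite (near_shift 0 x) subr0 => fg.
  near=> y.
  rewrite !fctE/= -(_ : f (shift x y) = g (shift x y)); last by near: y.
  by rewrite -fgx; near: y.
by apply/diff_locallyP; rewrite (diff_unique dfc H).
Unshelve. all: by end_near. Qed.

Section Vector.
Context {m : nat}.
Implicit Types (f g : 'rV[R]_m -> R^o) (x v : 'rV[R]_m).

Lemma derive_coord (W : normedModType R) (f : 'rV[R]_m -> W) x v :
  differentiable f x ->
  'D_v f x = \sum_l v 0 l *: 'D_(delta_mx 0 l) f x.
Proof.
move=> df; rewrite deriveE// {1}(row_sum_delta v) linear_sum.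
by apply: eq_bigr => l _; rewrite linearZ deriveE.
Qed.

Lemma differentiable_entry n (f : 'rV[R]_m -> 'rV[R]_n) x l :
  differentiable f x -> differentiable (fun y => f y 0 l : R^o) x.
Proof.
move=> df; apply: (@differentiable_comp _ _ _ _ f (fun M => M 0 l)) => //.
exact: differentiable_coord.
Qed.

Lemma derive_entry n (f : 'rV[R]_m -> 'rV[R]_n) x v l :
  derivable f x v -> ('D_v f x) 0 l = 'D_v (fun y => f y 0 l : R^o) x.
Proof. by move=> df; rewrite derive_mx// mxE. Qed.

Lemma differentiable_row n (f : 'rV[R]_m -> 'rV[R]_n) x :
  (forall l, differentiable (fun y => f y 0 l : R^o) x) -> differentiable f x.
Proof.
move=> df; have -> : f = \sum_l (fun y => f y 0 l *: delta_mx 0 l).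
  by apply/funext => y; rewrite fct_sumE [LHS]row_sum_delta.
by apply: differentiable_sum => l; exact: differentiableZl.
Qed.

(* [Ck k U f]: f is k + 1 times differentiable on U. *)
Fixpoint Ck (k : nat) (U : set 'rV[R]_m) f : Prop :=
  (forall x, U x -> differentiable f x) /\
  if k is k'.+1 then forall v, Ck k' U ('D_v f) else True.

Lemma Ck_differentiable k U f x : Ck k U f -> U x -> differentiable f x.
Proof. by case: k => [|k] [+ _]; exact. Qed.

Lemma CkS k U f : Ck k.+1 U f -> Ck k U f.
Proof.
elim: k f => [|k IH] f [df Hf]; first by split.
by split => // v; exact: IH.
Qed.

(** [smooth_on] applies the directions of a list starting from its last element, while [Ck] peels
    derivatives off [f] itself; reversing the list matches the two. The recursive form is the one
    suited to induction with the Leibniz and chain rules. *)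
Lemma smooth_onP U f : smooth_on U f <-> forall k, Ck k U f.
Proof.
split=> [sf k|Cf vs].
  have {sf} sf : forall vs x, U x -> differentiable
      (foldl (fun (g : 'rV[R]_m -> R^o) v => 'D_v g) f vs) x.
    by move=> vs x Ux; rewrite -[vs]revK foldl_rev; exact: sf.
  elim: k f sf => [|k IH] f sf; first by split => // x Ux; exact: (sf [::]).
  split=> [x Ux|v]; first exact: (sf [::]).
  by apply: IH => vs x Ux; exact: (sf (v :: vs)).
rewrite -foldl_rev; elim: (rev vs) f Cf => [|v s IH] f Cf x Ux /=.
  exact: (Ck_differentiable (Cf 0%N) Ux).
by apply: IH => // k; have [_] := Cf k.+1; exact.
Qed.

Lemma Ck_ext k U f g : open U -> {in U, f =1 g} -> Ck k U f -> Ck k U g.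
Proof.
move=> oU; elim: k f g => [|k IH] f g fg [df Hf].
  split=> // x Ux; apply: near_eq_differentiable (df x Ux).
  by apply: filterS (open_nbhs_nbhs (conj oU Ux)) => y Uy; apply: fg; rewrite inE.
split=> [x Ux|v].
  apply: near_eq_differentiable (df x Ux).
  by apply: filterS (open_nbhs_nbhs (conj oU Ux)) => y Uy; apply: fg; rewrite inE.
apply: IH (Hf v) => x; rewrite inE => Ux; apply: near_eq_derive.
by apply: filterS (open_nbhs_nbhs (conj oU Ux)) => y Uy; apply: fg; rewrite inE.
Qed.

Lemma Ck_cst k U (c : R) : Ck k U (cst c : 'rV[R]_m -> R^o).
Proof.
elim: k c => [|k IH] c; split=> // v.
rewrite (_ : 'D_v _ = cst 0)//; by apply/funext => x; exact: derive_cst.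
Qed.

Lemma CkD k U f g : open U -> Ck k U f -> Ck k U g ->
  Ck k U (fun x => f x + g x).
Proof.
move=> oU; elim: k f g => [|k IH] f g [df Hf] [dg Hg].
  by split=> // x Ux; exact: differentiableD (df x Ux) (dg x Ux).
split=> [x Ux|v]; first exact: differentiableD (df x Ux) (dg x Ux).
apply: (Ck_ext oU _ (IH _ _ (Hf v) (Hg v))) => x; rewrite inE => Ux.
by rewrite deriveD//; apply: diff_derivable; [exact: df|exact: dg].
Qed.

Lemma CkM k U f g : open U -> Ck k U f -> Ck k U g ->
  Ck k U (fun x => f x * g x).
Proof.
move=> oU; elim: k f g => [|k IH] f g Cf Cg.
  by split=> // x Ux; have [/(_ x Ux)? _] := Cf; have [/(_ x Ux)? _] := Cg;
    exact: differentiableM.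
have [df Hf] := Cf; have [dg Hg] := Cg.
split=> [x Ux|v]; first exact: differentiableM (df x Ux) (dg x Ux).
have := CkD oU (IH _ _ (CkS Cf) (Hg v)) (IH _ _ (CkS Cg) (Hf v)).
apply: (Ck_ext oU) => x; rewrite inE => Ux.
by rewrite deriveM//; apply: diff_derivable; [exact: df|exact: dg].
Qed.

Lemma Ck_sum k U n (f : 'I_n -> 'rV[R]_m -> R^o) : open U ->
  (forall i, Ck k U (f i)) -> Ck k U (fun x => \sum_i f i x).
Proof.
move=> oU; elim: n f => [|n IH] f Cf.
  by rewrite (_ : (fun x => _) = cst 0);
    [exact: Ck_cst|apply/funext => x; rewrite big_ord0].
rewrite (_ : (fun x => _) = fun x => f ord0 x + \sum_i f (lift ord0 i) x).
  by apply: CkD => //; exact: IH.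
by apply/funext => x; rewrite big_ord_recl.
Qed.

Lemma smooth_on_differentiable (W : normedModType R) U (f : 'rV[R]_m -> W) x :
  smooth_on U f -> U x -> differentiable f x.
Proof. by move=> /(_ [::]); exact. Qed.

Lemma smooth_on_derive (W : normedModType R) U (f : 'rV[R]_m -> W) v :
  smooth_on U f -> smooth_on U ('D_v f).
Proof. by move=> sf vs x Ux; have := sf (rcons vs v) x Ux; rewrite foldr_rcons. Qed.

Lemma smooth_on_sub (W : normedModType R) U V (f : 'rV[R]_m -> W) :
  V `<=` U -> smooth_on U f -> smooth_on V f.
Proof. by move=> VU sf vs x /VU; exact: sf. Qed.

(** The iterated derivatives are those of the total function [f]; the set only says at which points
    they are tested. *)
Lemma smooth_on_local (W : normedModType R) U (f : 'rV[R]_m -> W) :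
  (forall x, U x -> exists2 V, V x & smooth_on V f) -> smooth_on U f.
Proof. by move=> H vs x /H[V Vx]; exact. Qed.

Lemma smooth_on_ext U f g : open U -> {in U, f =1 g} ->
  smooth_on U f -> smooth_on U g.
Proof. by move=> oU fg /smooth_onP Cf; apply/smooth_onP => k; exact: Ck_ext fg _. Qed.

Lemma smooth_on_cst U (c : R) : smooth_on U (cst c : 'rV[R]_m -> R^o).
Proof. by apply/smooth_onP => k; exact: Ck_cst. Qed.

Lemma smooth_onD U f g : open U -> smooth_on U f -> smooth_on U g ->
  smooth_on U (fun x => f x + g x : R^o).
Proof. by move=> oU /smooth_onP Cf /smooth_onP Cg; apply/smooth_onP => k; exact: CkD. Qed.

Lemma smooth_onM U f g : open U -> smooth_on U f -> smooth_on U g ->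
  smooth_on U (fun x => f x * g x : R^o).
Proof. by move=> oU /smooth_onP Cf /smooth_onP Cg; apply/smooth_onP => k; exact: CkM. Qed.

Lemma smooth_on_sum U n (f : 'I_n -> 'rV[R]_m -> R^o) : open U ->
  (forall i, smooth_on U (f i)) -> smooth_on U (fun x => \sum_i f i x : R^o).
Proof.
by move=> oU sf; apply/smooth_onP => k; apply: Ck_sum => // i; have /smooth_onP := sf i; exact.
Qed.

Lemma smooth_on_coord U l : smooth_on U (fun x : 'rV[R]_m => x 0 l : R^o).
Proof.
have df (x : 'rV[R]_m) : differentiable (fun y : 'rV[R]_m => y 0 l : R^o) x.
  exact: differentiable_coord.
apply/smooth_onP => -[|k]; split=> // v.
rewrite (_ : 'D_v _ = cst (v 0 l)); first exact: Ck_cst.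
apply/funext => x; rewrite -derive_entry; last exact: derivable_id.
by rewrite derive_id.
Qed.

Lemma smooth_on_entry n U (f : 'rV[R]_m -> 'rV[R]_n) l : open U ->
  smooth_on U f -> smooth_on U (fun x => f x 0 l : R^o).
Proof.
move=> oU sf; apply/smooth_onP => k; elim: k f sf => [|k IH] f sf.
  by split=> // x Ux; exact/differentiable_entry/(smooth_on_differentiable sf Ux).
split=> [x Ux|v]; first exact/differentiable_entry/(smooth_on_differentiable sf Ux).
apply: Ck_ext (IH _ (smooth_on_derive v sf)) => // x; rewrite inE => Ux.
by rewrite -derive_entry//; apply/diff_derivable/(smooth_on_differentiable sf Ux).
Qed.

End Vector.

End Calculus.

(** * Chain rule and equality of mixed second derivatives *)

Section Composition.
Context {R : realType}.

Lemma derive_comp (U V W : normedModType R) (f : U -> V) (g : V -> W) x v :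
  differentiable f x -> differentiable g (f x) ->
  'D_v (g \o f) x = 'D_('D_v f x) g (f x).
Proof.
move=> df dg; rewrite (deriveE _ (differentiable_comp df dg)) diff_comp//=.
by rewrite -(deriveE v df) -deriveE.
Qed.

(** Induction on the order: a derivative of the composite is a sum of products of a first derivative
    of an entry of [psi] with a partial derivative of [f] composed with [psi]. *)
Lemma Ck_comp m n k U V (f : 'rV[R]_n -> R^o) (psi : 'rV[R]_m -> 'rV[R]_n) :
  open U -> (forall x, U x -> V (psi x)) -> Ck k V f ->
  (forall l, Ck k U (fun x => psi x 0 l : R^o)) -> Ck k U (f \o psi : _ -> R^o).
Proof.
move=> oU UV; elim: k f => [|k IH] f Cf Cpsi.
  split=> // x Ux; apply: differentiable_comp.
    by apply: differentiable_row => l; exact: Ck_differentiable (Cpsi l) Ux.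
  exact: Ck_differentiable Cf (UV _ Ux).
have dpsi x : U x -> differentiable psi x.
  by move=> Ux; apply: differentiable_row => l; exact: Ck_differentiable (Cpsi l) Ux.
split=> [x Ux|v].
  by apply: differentiable_comp; [exact: dpsi|exact: Ck_differentiable Cf (UV _ Ux)].
have H : Ck k U (fun x => \sum_l 'D_v (fun y => psi y 0 l : R^o) x *
    'D_(delta_mx 0 l) f (psi x) : R^o).
  apply: Ck_sum => // l; apply: CkM => //; first by have [_] := Cpsi l; exact.
  by apply: (IH ('D_(delta_mx 0 l) f)); [have [_] := Cf; exact|move=> j; exact/CkS].
apply: Ck_ext H => // x; rewrite inE => Ux.
have df := Ck_differentiable Cf (UV _ Ux).
rewrite derive_comp//; last exact: dpsi.
rewrite (derive_coord _ df); apply: eq_bigr => l _.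
by rewrite derive_entry//; exact/diff_derivable/dpsi.
Qed.

Lemma smooth_on_comp m n U V (f : 'rV[R]_n -> R^o) (psi : 'rV[R]_m -> 'rV[R]_n) :
  open U -> (forall x, U x -> V (psi x)) -> smooth_on V f ->
  (forall l, smooth_on U (fun x => psi x 0 l : R^o)) ->
  smooth_on U (f \o psi : _ -> R^o).
Proof.
move=> oU UV /smooth_onP Cf Cpsi; apply/smooth_onP => k.
by apply: Ck_comp (Cf k) _ => // l; have /smooth_onP := Cpsi l; exact.
Qed.

(** The mean value theorem is applied once, to the increment in direction [v] as a function of the
    displacement along [u]. The resulting difference of values of ['D_u f] is then estimated by its
    differentiability at [x]. *)
Lemma mixed_difference (V : normedModType R) (f : V -> R^o) x u v :
  (\forall y \near x, differentiable f y) -> differentiable ('D_u f) x ->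
  forall e : R, 0 < e -> \forall h \near 0^'+,
    `|f (x + h *: u + h *: v) - f (x + h *: u) - f (x + h *: v) + f x
      - h ^+ 2 * 'D_v ('D_u f) x| <= e * h ^+ 2.
Proof.
move=> df dg e e0.
set g := 'D_u f.
have [M [M0 MuMv]] : exists M, 0 < M /\ `|u| + `|v| <= M.
  exists (`|u| + `|v| + 1); split; last by rewrite lerDl.
  by rewrite ltr_pwDr// addr_ge0.
(* Two remainders of this size get subtracted, at displacements of norm at most [h * M]. Each is at
   most [e * h / 2], and the mean value theorem supplies the other factor [h]. *)
have : \forall k \near 0, `|g (k + x) - g x - 'd g x k| <= e / (M + M) * `|k|.
  have /diff_locally/eqaddoP/(_ (e / (M + M))) := dg.
  have -> : 0 < e / (M + M) by rewrite divr_gt0// addr_gt0.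
  move=> /(_ isT); apply: filterS => k; rewrite !fctE/=.
  by rewrite opprD addrA.
have : \forall k \near 0, differentiable f (k + x).
  by move: df; rewrite (near_shift 0 x) subr0.
move=> /filterI/[apply] /nbhs_ballP[d /= d0 Hd].
have dM0 : 0 < d / M by rewrite divr_gt0.
near=> h.
have h0 : 0 < h by [].
have hd : h * M < d.
  rewrite -ltr_pdivlMr//; near: h; exact: nbhs_right_lt.
have bnd s t : 0 <= s <= h -> 0 <= t <= h -> `|s *: u + t *: v| <= h * M.
  move=> /andP[s0 sh] /andP[t0 th].
  rewrite (le_trans (ler_normD _ _))// !normrZ !ger0_norm//.
  rewrite (@le_trans _ _ (h * (`|u| + `|v|)))//; last by rewrite ler_pM2l.
  by rewrite mulrDr lerD// ler_wpM2r.
have Hst s t : 0 <= s <= h -> 0 <= t <= h ->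
    differentiable f (x + s *: u + t *: v) /\
    `|g (x + s *: u + t *: v) - g x - (s * 'd g x u + t * 'd g x v)| <= e / (M + M) * (h * M).
  move=> hs ht; have b := bnd _ _ hs ht.
  have [] := Hd (s *: u + t *: v).
    by rewrite -ball_normE/= sub0r normrN (le_lt_trans b).
  rewrite addrC addrA linearD !linearZ/= => df1 H; split=> //.
  rewrite (le_trans H)// ler_wpM2l// divr_ge0 ?ltW// addr_gt0//.
pose phi s := f (x + s *: u + h *: v) - f (x + s *: u).
have hh : 0 <= h <= h by rewrite lexx ltW.
have h00 : 0 <= (0 : R) <= h by rewrite lexx ltW.
have dline s w : differentiable f (x + s *: u + w) ->
    is_derive (s : R^o) 1 (fun s : R => f (x + s *: u + w)) (g (x + s *: u + w)).
  move=> dfs.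
  pose l (t : R^o) : V := x + t *: u + w.
  have lE : l = (fun t : R^o => t *: u) + cst (x + w).
    by apply/funext => t; rewrite /l/= addrAC addrC.
  have dl : differentiable l s.
    by rewrite lE; apply: differentiableD.
  have lD : 'D_1 l s = u.
    by rewrite deriveE// lE diffD// diff_val diff_cst/= ?fctE scale1r addr0.
  apply: DeriveDef.
    by apply: diff_derivable; exact: (differentiable_comp dl dfs).
  by rewrite (derive_comp _ dl dfs) lD.
have dphi s : 0 <= s <= h -> is_derive (s : R^o) 1 phi
    (g (x + s *: u + h *: v) - g (x + s *: u)).
  move=> hs.
  have d1 := dline s (h *: v) (Hst s h hs hh).1.
  have d2 : is_derive (s : R^o) 1 (fun s : R => f (x + s *: u)) (g (x + s *: u)).
    have := dline s 0; rewrite addr0.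
    under eq_fun do rewrite addr0.
    by apply; have [] := Hst s 0 hs h00; rewrite scale0r addr0.
  exact: is_deriveB.
have dphi_oo s : s \in `]0, h[ -> is_derive (s : R^o) 1 phi
    (g (x + s *: u + h *: v) - g (x + s *: u)).
  by rewrite in_itv/= => /andP[s0 sh]; apply: dphi; rewrite !ltW.
have cphi : {within `[0, h], continuous phi}.
  apply: derivable_within_continuous => s; rewrite in_itv/= => hs.
  exact: (@ex_derive _ _ _ _ _ _ _ (dphi s hs)).
have [c] := MVT h0 dphi_oo cphi.
rewrite in_itv/= => /andP[c0 ch].
rewrite /phi !scale0r !addr0 subr0 => E.
rewrite (_ : _ - f (x + h *: v) + f x =
  f (x + h *: u + h *: v) - f (x + h *: u) - (f (x + h *: v) - f x)); last by ring.
rewrite E.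
have hc : 0 <= c <= h by rewrite !ltW.
have [_ H1] := Hst c h hc hh.
have [_] := Hst c 0 hc h00; rewrite scale0r addr0 mul0r addr0 => H2.
rewrite deriveE// (_ : _ - _ = h * ((g (x + c *: u + h *: v) - g x - (c * 'd g x u + h * 'd g x v))
  - (g (x + c *: u) - g x - c * 'd g x u))); last by ring.
rewrite normrM gtr0_norm// (_ : e * _ = h * (e * h)); last by ring.
rewrite ler_pM2l//.
rewrite (le_trans (ler_normB _ _))// (le_trans (lerD H1 H2))//.
rewrite le_eqVlt; apply/orP; left; apply/eqP.
by field; rewrite gt_eqF// addr_gt0.
Unshelve. all: by end_near. Qed.

(** The mixed second difference is symmetric in [u] and [v]; divided by [h ^+ 2] it approximates
    both iterated derivatives. *)
Lemma derive_sym (V : normedModType R) (f : V -> R^o) x u v :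
  (\forall y \near x, differentiable f y) ->
  differentiable ('D_u f) x -> differentiable ('D_v f) x ->
  'D_v ('D_u f) x = 'D_u ('D_v f) x.
Proof.
move=> df du dv; apply/eqP; rewrite -subr_eq0 -normr_le0.
apply/ler_addgt0Pr => e e0; rewrite add0r.
have e20 : 0 < e / 2 by rewrite divr_gt0.
have H1 := mixed_difference v df du e20.
have H2 := mixed_difference u df dv e20.
have [h [[h0 {}H1] {}H2]] :=
  filter_ex (filterI (filterI (nbhs_right_gt (0 : R)) H1) H2).
have h20 : 0 < h ^+ 2 by rewrite exprn_gt0.
have aux (a b A B : R) : A = B -> `|A - h ^+ 2 * a| <= e / 2 * h ^+ 2 ->
    `|B - h ^+ 2 * b| <= e / 2 * h ^+ 2 -> `|a - b| <= e.
  move=> -> Ha Hb; rewrite -(ler_pM2l h20) -{1}(gtr0_norm h20) -normrM.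
  rewrite (_ : _ * (a - b) = (B - h ^+ 2 * b) - (B - h ^+ 2 * a)); last by ring.
  rewrite (le_trans (ler_normB _ _))// (le_trans (lerD Hb Ha))//.
  by rewrite -mulrDl -splitr mulrC.
apply: aux H1 H2; rewrite [x + h *: v + _]addrAC; congr (_ + _).
by rewrite -!addrA; congr (_ + _); rewrite addrC.
Qed.

End Composition.

(** * Brackets of related vector fields *)

Section Brackets.
Context {R : realType}.

Lemma deriveBl (V W : normedModType R) (f : V -> W) x u v :
  differentiable f x -> 'D_(u - v) f x = 'D_u f x - 'D_v f x.
Proof. by move=> df; rewrite !(deriveE _ df) linearB. Qed.

(* [*:%R] on [R^o] and [*%R] on [R] are convertible but slow to unify. *)
Lemma deriveM_mul (V : normedModType R) (f g : V -> R^o) x v :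
  differentiable f x -> differentiable g x ->
  'D_v (fun y => f y * g y : R^o) x = 'D_v f x * g x + f x * 'D_v g x :> R.
Proof.
move=> df dg; rewrite addrC [X in _ + X]mulrC.
exact: (deriveM (diff_derivable df) (diff_derivable dg)).
Qed.

Lemma derive_coord_mul m (f : 'rV[R]_m -> R^o) x v : differentiable f x ->
  'D_v f x = \sum_l v 0 l * 'D_(delta_mx 0 l) f x :> R.
Proof. exact: derive_coord. Qed.

Lemma derive_along_field m (U : set 'rV[R]_m) (psi : 'rV[R]_m -> R^o)
    (Y : 'rV[R]_m -> 'rV[R]_m) x v :
  open U -> U x -> smooth_on U psi -> differentiable Y x ->
  'D_v (fun y => 'D_(Y y) psi y : R^o) x =
  'D_('D_v Y x) psi x + 'D_v ('D_(Y x) psi) x.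
Proof.
move=> oU Ux spsi dY.
have dpsi y : U y -> differentiable psi y by exact: smooth_on_differentiable.
have ddpsi u y : U y -> differentiable ('D_u psi) y.
  by move=> Uy; exact: (smooth_on_differentiable (smooth_on_derive u spsi) Uy).
have Unear : \forall y \near x, U y by exact: open_nbhs_nbhs.
have dpsin : \forall y \near x, differentiable psi y by apply: filterS Unear.
transitivity ('D_v (\sum_l (fun y => Y y 0 l * 'D_(delta_mx 0 l) psi y) : _ -> R^o) x).
  apply: near_eq_derive; apply: filterS Unear => y Uy.
  by rewrite (derive_coord _ (dpsi y Uy)) fct_sumE.
have dYl l : differentiable (fun y => Y y 0 l : R^o) x by exact: differentiable_entry.
rewrite derive_sum; last first.
  by move=> l; apply: diff_derivable; apply: differentiableM => //; exact: ddpsi.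
transitivity (\sum_l ('D_v Y x 0 l * 'D_(delta_mx 0 l) psi x +
    Y x 0 l * 'D_(delta_mx 0 l) ('D_v psi) x) : R).
  apply: eq_bigr => l _; rewrite (deriveM_mul _ (dYl l) (ddpsi _ _ Ux)).
  rewrite (derive_entry _ (diff_derivable dY)).
  by rewrite (derive_sym dpsin (ddpsi _ _ Ux) (ddpsi _ _ Ux)).
rewrite big_split; rewrite -(derive_coord_mul _ (dpsi x Ux)).
rewrite -(derive_coord_mul _ (ddpsi v x Ux)).
by rewrite (derive_sym dpsin (ddpsi _ _ Ux) (ddpsi _ _ Ux)).
Qed.

(* The second derivatives of phi cancel by symmetry. *)
Lemma bracket_related m n (U : set 'rV[R]_m) (phi : 'rV[R]_m -> 'rV[R]_n)
    (X Y : 'rV[R]_m -> 'rV[R]_m) (X' Y' : 'rV[R]_n -> 'rV[R]_n) x :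
  open U -> U x -> smooth_on U phi ->
  (forall y, U y -> X' (phi y) = 'D_(X y) phi y) ->
  (forall y, U y -> Y' (phi y) = 'D_(Y y) phi y) ->
  differentiable X x -> differentiable Y x ->
  differentiable X' (phi x) -> differentiable Y' (phi x) ->
  'D_(X' (phi x)) Y' (phi x) - 'D_(Y' (phi x)) X' (phi x) =
  'D_('D_(X x) Y x - 'D_(Y x) X x) phi x.
Proof.
move=> oU Ux sphi relX relY dX dY dX' dY'.
have dphi y : U y -> differentiable phi y by exact: smooth_on_differentiable.
have Unear : \forall y \near x, U y by exact: open_nbhs_nbhs.
(* This differentiates the relation between [W] and [W'] along [Z]: the chain rule treats
   [W' \o phi], and [derive_along_field] treats ['D_(W y) phi y]. *)
have step (Z W : 'rV[R]_m -> 'rV[R]_m) (Z' W' : 'rV[R]_n -> 'rV[R]_n) j :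
    (forall y, U y -> Z' (phi y) = 'D_(Z y) phi y) ->
    (forall y, U y -> W' (phi y) = 'D_(W y) phi y) ->
    differentiable W x -> differentiable W' (phi x) ->
    ('D_(Z' (phi x)) W' (phi x)) 0 j =
    'D_('D_(Z x) W x) (fun y => phi y 0 j : R^o) x +
    'D_(Z x) ('D_(W x) (fun y => phi y 0 j : R^o)) x.
  move=> relZ relW dW dW'.
  rewrite derive_entry; last exact: diff_derivable.
  rewrite relZ// -(derive_comp _ (dphi x Ux)); last exact: differentiable_entry.
  rewrite -(derive_along_field _ oU Ux)//; last exact: smooth_on_entry.
  apply: near_eq_derive; apply: filterS Unear => y Uy /=.
  by rewrite relW// derive_entry//; exact/diff_derivable/dphi.
apply/rowP => j; rewrite !mxE !(step X Y X' Y')// !(step Y X Y' X')//.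
have sphij : smooth_on U (fun y => phi y 0 j : R^o) by exact: smooth_on_entry.
have dphij y : U y -> differentiable (fun y => phi y 0 j : R^o) y.
  exact: smooth_on_differentiable.
rewrite derive_entry; last exact/diff_derivable/dphi.
rewrite deriveBl; last exact: dphij.
rewrite (@derive_sym _ _ (fun y => phi y 0 j) x (Y x) (X x)).
- have aux (a b c : R) : a + b - (c + b) = a - c by ring.
  exact: aux.
- by apply: filterS Unear.
- exact: (smooth_on_differentiable (smooth_on_derive _ sphij) Ux).
- exact: (smooth_on_differentiable (smooth_on_derive _ sphij) Ux).
Qed.

End Brackets.

(** * Tangent maps *)

Section Jacobian.
Context {R : realType}.

Lemma row_jacobian m n (f : 'rV[R]_m -> 'rV[R]_n) (x : 'rV[R]_m) k :
  differentiable f x -> row k (jacobian f x) = 'D_(delta_mx 0 k) f x.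
Proof. by move=> df; rewrite (deriveEjacobian _ df) rowE. Qed.

Lemma jacobian_comp m n p (f : 'rV[R]_m -> 'rV[R]_n) (g : 'rV[R]_n -> 'rV[R]_p) (x : 'rV[R]_m) :
  differentiable f x -> differentiable g (f x) ->
  jacobian (g \o f) x = jacobian f x *m jacobian g (f x).
Proof.
move=> df dg; apply/row_matrixP => k; rewrite row_mul 2!rowE.
rewrite -(deriveEjacobian _ df) -(deriveEjacobian _ dg).
by rewrite -(deriveEjacobian _ (differentiable_comp df dg)) derive_comp.
Qed.

Lemma near_eq_jacobian m n (f g : 'rV[R]_m -> 'rV[R]_n) (x : 'rV[R]_m) :
  (\forall y \near x, f y = g y) -> differentiable f x ->
  jacobian f x = jacobian g x.
Proof.
move=> fg df; have dg := near_eq_differentiable fg df.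
apply/row_matrixP => k.
apply: (etrans (row_jacobian k df)); apply: (etrans _ (esym (row_jacobian k dg))).
exact: near_eq_derive.
Qed.

Lemma jacobian_id m (x : 'rV[R]_m) : jacobian id x = 1%:M.
Proof.
apply/row_matrixP => k; rewrite row1 rowE.
have did : differentiable (id : 'rV[R]_m -> 'rV[R]_m) x by [].
by rewrite -(deriveEjacobian _ did) derive_id.
Qed.

Lemma smooth_derive_along m n (V : set 'rV[R]_m) (phi : 'rV[R]_m -> 'rV[R]_n)
    (F : 'rV[R]_m -> 'rV[R]_m) l :
  open V -> smooth_on V phi ->
  (forall k, smooth_on V (fun y => F y 0 k : R^o)) ->
  smooth_on V (fun y => ('D_(F y) phi y) 0 l : R^o).
Proof.
move=> oV sphi sF.
have sphil : smooth_on V (fun y => phi y 0 l : R^o) by exact: smooth_on_entry.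
have : smooth_on V (fun y => \sum_k F y 0 k *
    'D_(delta_mx 0 k) (fun y => phi y 0 l : R^o) y : R^o).
  apply: smooth_on_sum => // k; apply: smooth_onM => //.
  exact: smooth_on_derive.
apply: smooth_on_ext => // y; rewrite inE => Vy.
rewrite derive_entry; last exact/diff_derivable/(smooth_on_differentiable sphi Vy).
exact/esym/derive_coord/(smooth_on_differentiable sphil Vy).
Qed.

End Jacobian.

Section Manifold.
Context {R : realType} {n : nat} {M : topologicalType} {A : atlas R n M}.
Hypothesis hA : is_manifold A.

Lemma chart_rangeP i q : dom i q -> chart_range i (chart (a := A) i q).
Proof. by move=> iq; exists q. Qed.

Lemma paramK i x : chart_range (A := A) i x ->
  chart i (param i x) = x /\ dom i (param i x).
Proof. by move=> [q iq <-]; rewrite (chartK hA iq). Qed.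

Lemma near_dom i q : dom (a := A) i q -> \forall p \near q, dom i p.
Proof. by move=> iq; apply: open_nbhs_nbhs; split => //; exact: dom_open hA i. Qed.

Lemma near_range i x : chart_range (A := A) i x -> \forall y \near x, chart_range i y.
Proof. by move=> ix; apply: open_nbhs_nbhs; split => //; exact: range_open hA i. Qed.

Lemma near_param i x (P : set M) : chart_range (A := A) i x ->
  (\forall p \near param i x, P p) -> \forall y \near x, P (param i y).
Proof. by move=> ix; exact: (param_continuous hA ix). Qed.

End Manifold.

Section TangentMap.
Context {R : realType} {m n : nat} {M N : topologicalType}.
Context {A : atlas R m M} {B : atlas R n N}.

Definition chart_rep (i : chart_index A) (k : chart_index B) (f : M -> N) :
  'rV[R]_m -> 'rV[R]_n := chart k \o f \o param i.

Definition diff_map (f : M -> N) : Prop :=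
  continuous f /\ forall i k q, dom i q -> dom k (f q) ->
    differentiable (chart_rep i k f) (chart i q).

End TangentMap.

(** The matrix acts on row vectors from the right, so composites read from left to right. Both
    charts are explicit: with [f] the identity this is a change of coordinates. *)
HB.lock Definition tangent (R : realType) (m n : nat) (M N : topologicalType)
    (A : atlas R m M) (B : atlas R n N) (i : chart_index A) (k : chart_index B)
    (f : M -> N) (q : M) : 'M[R]_(m, n) :=
  jacobian (chart_rep i k f) (chart i q).
Arguments tangent {R m n M N A B} i k f q.

Section TangentComp.
Context {R : realType} {m n p : nat} {M N P : topologicalType}.
Context {A : atlas R m M} {B : atlas R n N} {C : atlas R p P}.
Hypotheses (hA : is_manifold A) (hB : is_manifold B).

Lemma chart_rep_comp (f : M -> N) (g : N -> P) (i : chart_index A) (k : chart_index B)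
    (l : chart_index C) q :
  continuous f -> dom i q -> dom k (f q) ->
  \forall y \near chart i q,
    (chart_rep k l g \o chart_rep i k f) y = chart_rep i l (g \o f) y.
Proof.
move=> cf iq kfq; have := near_dom hB kfq; rewrite -{1}(chartK hA iq).
move=> /(cf _) /(near_param hA (chart_rangeP iq)); apply: filterS => y kfy.
by rewrite /chart_rep/= (chartK hB kfy).
Qed.

(** The middle chart cancels only near the point, where continuity of [f] keeps the values in its
    domain; Jacobians are local, so this is enough. *)
Lemma tangent_comp (f : M -> N) (g : N -> P) (i : chart_index A) (k : chart_index B)
    (l : chart_index C) q :
  diff_map (A := A) (B := B) f -> diff_map (A := B) (B := C) g ->
  dom i q -> dom k (f q) -> dom l (g (f q)) ->
  tangent i l (g \o f) q = tangent i k f q *m tangent k l g (f q).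
Proof.
move=> [cf df] [cg dg] iq kfq lgfq.
have E : chart_rep i k f (chart i q) = chart k (f q).
  by rewrite /chart_rep/= (chartK hA iq).
have dfq := df i k q iq kfq.
have dgq : differentiable (chart_rep k l g) (chart_rep i k f (chart i q)).
  by rewrite E; exact: dg.
rewrite tangent.unlock -E -(jacobian_comp dfq dgq).
apply: esym.
exact: (near_eq_jacobian (chart_rep_comp g l cf iq kfq) (differentiable_comp dfq dgq)).
Qed.

Lemma tangent_ext (f g : M -> N) (i : chart_index A) (k : chart_index B) q :
  f =1 g -> tangent i k f q = tangent i k g q.
Proof. by move=> /funext ->. Qed.

End TangentComp.

Section Transition.
Context {R : realType} {n : nat} {M : topologicalType} {A : atlas R n M}.
Hypothesis hA : is_manifold A.

(** This is smoothness of the transition maps. It lets the chain rule alone say how changes of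
    coordinates compose and invert. *)
Lemma diff_map_id : diff_map (A := A) (B := A) id.
Proof.
split; first by move=> q; exact: cvg_id.
move=> i k q iq kq.
have xU : (chart i @` (dom i `&` dom k)) (chart i q) by exists q.
exact: (smooth_on_differentiable (transition_smooth hA (i := i) (j := k)) xU).
Qed.

Lemma tangent_id (i : chart_index A) q : dom i q -> tangent i i id q = 1%:M.
Proof.
move=> iq; rewrite tangent.unlock -(jacobian_id (chart i q)); apply/esym.
apply: (@near_eq_jacobian _ _ _ id); last by [].
apply: filterS (near_range hA (chart_rangeP iq)) => y /(paramK hA)[E _].
by rewrite /chart_rep/= E.
Qed.

Lemma tangent_idK (i k : chart_index A) q : dom i q -> dom k q ->
  tangent i k id q *m tangent k i id q = 1%:M.
Proof.
move=> iq kq; rewrite -(tangent_id iq).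
by rewrite -(tangent_comp hA hA diff_map_id diff_map_id iq kq iq).
Qed.

Lemma field_in_chart X i q : dom i q ->
  field_in (A := A) i X (chart i q) = X q *m tangent (chart_at A q) i id q.
Proof. by move=> iq; rewrite tangent.unlock /field_in/= (chartK hA iq). Qed.

Lemma field_in_chart_at X q :
  field_in (A := A) (chart_at A q) X (chart (chart_at A q) q) = X q.
Proof.
have h := chart_at_dom hA q.
by rewrite field_in_chart// tangent_id// mulmx1.
Qed.

(** Entry by entry, because the rules for sums, products and composites are proved for scalar
    functions. *)
Definition smooth_entries (X : M -> 'rV[R]_n) := forall (i : chart_index A) l,
  smooth_on (chart_range i) (fun x => field_in i X x 0 l : R^o).

Lemma smooth_entries_differentiable X (i : chart_index A) q :
  smooth_entries X -> dom i q -> differentiable (field_in i X) (chart i q).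
Proof.
move=> sX iq; apply: differentiable_row => l.
exact: (smooth_on_differentiable (sX i l) (chart_rangeP iq)).
Qed.

End Transition.
Arguments smooth_entries {R n M} A X.

(** * Lie groups *)

Section RowDifferentiable.
Context {R : realType}.

Lemma differentiable_row_mx k m n (f : 'rV[R]_k -> 'rV[R]_m)
    (g : 'rV[R]_k -> 'rV[R]_n) (x : 'rV[R]_k) :
  differentiable f x -> differentiable g x ->
  differentiable (fun y => row_mx (f y) (g y)) x.
Proof.
move=> df dg; apply: differentiable_row => l.
under eq_fun do rewrite mxE.
by case: (fintype.split l) => j; exact: differentiable_entry.
Qed.

End RowDifferentiable.

Section LieGroup.
Context {R : realType} {n : nat} (G : lieGroup R n).
Local Notation A := (lie_atlas G).
Local Notation "x * y" := (lie_mul x y).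
Local Notation "x ^-1" := (lie_inv x).
Local Notation one := (lie_one G).
Let hG := lie_groupP G.
Let hA : is_manifold A := lie_manifold hG.

Lemma lie_mulgA (x y z : G) : x * (y * z) = x * y * z.
Proof. exact: lie_mulA hG x y z. Qed.

Lemma lie_mul1g (x : G) : one * x = x.
Proof. exact: lie_mul1 hG x. Qed.

Lemma lie_mulVg (x : G) : x^-1 * x = one.
Proof. exact: lie_mulV hG x. Qed.

Lemma lie_mulgV (x : G) : x * x^-1 = one.
Proof.
rewrite -(lie_mul1g (x * x^-1)) -{1}(lie_mulVg x^-1) -lie_mulgA (lie_mulgA x^-1).
by rewrite lie_mulVg lie_mul1g lie_mulVg.
Qed.

Lemma lie_mulg1 (x : G) : x * one = x.
Proof. by rewrite -(lie_mulVg x) lie_mulgA lie_mulgV lie_mul1g. Qed.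

Lemma lie_mulg_inv_eq (x y : G) : x * y = one -> y = x^-1.
Proof. by move=> xy; rewrite -(lie_mul1g y) -(lie_mulVg x) -lie_mulgA xy lie_mulg1. Qed.

Lemma lie_invgK (x : G) : x^-1^-1 = x.
Proof. exact/esym/lie_mulg_inv_eq/lie_mulVg. Qed.

Lemma lie_invMg (x y : G) : (x * y)^-1 = y^-1 * x^-1.
Proof.
apply/esym/lie_mulg_inv_eq.
by rewrite lie_mulgA -(lie_mulgA x) lie_mulgV lie_mulg1 lie_mulgV.
Qed.

Lemma lie_mul_cvg (T : topologicalType) (f g : T -> G) x :
  {for x, continuous f} -> {for x, continuous g} ->
  {for x, continuous (fun y => f y * g y)}.
Proof.
move=> cf cg; apply: (@continuous2_cvg _ _ _ _ _ _ f g (lie_mul (l := G)) (f x) (g x) _ cf cg).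
exact: (@lie_mul_continuous _ _ _ _ _ _ _ hG (f x, g x)).
Qed.

Definition mul_rep (i j k : chart_index A) (z : 'rV[R]_(n + n)) : 'rV[R]_n :=
  chart k (param i (lsubmx z) * param j (rsubmx z)).

Definition mul_dom (i j k : chart_index A) : set 'rV[R]_(n + n) :=
  [set z | [/\ chart_range i (lsubmx z), chart_range j (rsubmx z)
             & dom k (param i (lsubmx z) * param j (rsubmx z))]].

Lemma open_mul_dom i j k : open (mul_dom i j k).
Proof.
rewrite openE => z [iz jz kz].
have cl : {for z, continuous (fun z : 'rV[R]_(n + n) => param (a := A) i (lsubmx z))}.
  apply: (@continuous_comp _ _ _ (lsubmx : 'rV[R]_(n + n) -> 'rV[R]_n)).
    exact: continuous_lsubmx.
  exact: (param_continuous hA iz).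
have cr : {for z, continuous (fun z : 'rV[R]_(n + n) => param (a := A) j (rsubmx z))}.
  apply: (@continuous_comp _ _ _ (rsubmx : 'rV[R]_(n + n) -> 'rV[R]_n)).
    exact: continuous_rsubmx.
  exact: (param_continuous hA jz).
have zi : \forall y \near z, chart_range i (lsubmx y).
  exact: (continuous_lsubmx (near_range hA iz)).
have zj : \forall y \near z, chart_range j (rsubmx y).
  exact: (continuous_rsubmx (near_range hA jz)).
have zk : \forall y \near z, dom k (param i (lsubmx y) * param j (rsubmx y)).
  exact: (lie_mul_cvg cl cr (near_dom hA kz)).
rewrite /interior /=; near=> y; split; near: y => //.
Unshelve. all: by end_near. Qed.

Lemma mul_rep_smooth i j k : smooth_on (mul_dom i j k) (mul_rep i j k).
Proof. exact: (@lie_mul_smooth _ _ _ _ _ _ _ hG). Qed.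

Lemma mul_rep_differentiable i j k s t : dom i s -> dom j t -> dom k (s * t) ->
  differentiable (mul_rep i j k) (row_mx (chart i s) (chart j t)).
Proof.
move=> si tj stk; apply: (smooth_on_differentiable (@mul_rep_smooth i j k)).
split; rewrite ?row_mxKl ?row_mxKr; [exact: chart_rangeP..|].
by rewrite (chartK hA si) (chartK hA tj).
Qed.

Lemma chart_rep_mull i j k s : dom i s ->
  chart_rep j k (lie_mul s) = fun y => mul_rep i j k (row_mx (chart i s) y).
Proof.
move=> si; apply/funext => y.
by rewrite /chart_rep /mul_rep/= row_mxKl row_mxKr (chartK hA si).
Qed.

Lemma chart_rep_mulr i j k t : dom j t ->
  chart_rep i k (fun s => s * t) = fun y => mul_rep i j k (row_mx y (chart j t)).
Proof.
move=> tj; apply/funext => y.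
by rewrite /chart_rep /mul_rep/= row_mxKl row_mxKr (chartK hA tj).
Qed.

Lemma diff_map_mull s : diff_map (A := A) (B := A) (lie_mul s).
Proof.
split=> [t|j k t tj stk].
  by apply: lie_mul_cvg; [exact: cst_continuous|exact: cvg_id].
have si := chart_at_dom hA s; rewrite (chart_rep_mull j k si).
apply: (@differentiable_comp _ _ _ _ (fun y => row_mx (chart (chart_at A s) s) y)).
  exact: differentiable_row_mx.
exact: mul_rep_differentiable.
Qed.

Lemma diff_map_mulr t : diff_map (A := A) (B := A) (fun s => s * t).
Proof.
split=> [s|i k s si stk].
  by apply: lie_mul_cvg; [exact: cvg_id|exact: cst_continuous].
have tj := chart_at_dom hA t; rewrite (chart_rep_mulr i k tj).
apply: (@differentiable_comp _ _ _ _ (fun y => row_mx y (chart (chart_at A t) t))).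
  exact: differentiable_row_mx.
exact: mul_rep_differentiable.
Qed.

(** Left translations, and right ones below, become partial derivatives of the single map [mul_rep];
    invariant fields can then be related to fields on the product. *)
Lemma tangent_mull i j k s t v : dom i s -> dom j t -> dom k (s * t) ->
  v *m tangent j k (lie_mul s) t =
  'D_(row_mx 0 v) (mul_rep i j k) (row_mx (chart i s) (chart j t)).
Proof.
move=> si tj stk; have [_ /(_ j k t tj stk) d] := diff_map_mull s.
rewrite tangent.unlock -(deriveEjacobian v d) (chart_rep_mull j k si).
exact: derive_row_mxr.
Qed.

Lemma tangent_mulr i j k s t v : dom i s -> dom j t -> dom k (s * t) ->
  v *m tangent i k (fun s => s * t) s =
  'D_(row_mx v 0) (mul_rep i j k) (row_mx (chart i s) (chart j t)).
Proof.
move=> si tj stk; have [_ /(_ i k s si stk) d] := diff_map_mulr t.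
rewrite tangent.unlock -(deriveEjacobian v d) (chart_rep_mulr i k tj).
exact: derive_row_mxl.
Qed.

Definition inv_dom (i j : chart_index A) : set 'rV[R]_n :=
  [set x | chart_range i x /\ dom j (param i x)^-1].

Lemma open_inv_dom i j : open (inv_dom i j).
Proof.
rewrite openE => x [ix jx].
have := @lie_inv_continuous _ _ _ _ _ _ _ hG _ _ (near_dom hA jx).
move=> /(near_param hA ix)/(filterI (near_range hA ix)).
by apply: filterS.
Qed.

Lemma inv_rep_smooth i j : smooth_on (inv_dom i j) (chart_rep i j (lie_inv (l := G))).
Proof. exact: (@lie_inv_smooth _ _ _ _ _ _ _ hG). Qed.

Lemma diff_map_inv : diff_map (A := A) (B := A) (lie_inv (l := G)).
Proof.
split=> [q|i j q iq jq]; first exact: (@lie_inv_continuous _ _ _ _ _ _ _ hG).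
apply: (smooth_on_differentiable (@inv_rep_smooth i j)).
by split; [exact: chart_rangeP|rewrite (chartK hA iq)].
Qed.

End LieGroup.

(** * Left-invariant fields in arbitrary charts, and right-invariant fields *)

Section InvariantFields.
Context {R : realType} {n : nat} (G : lieGroup R n).
Local Notation A := (lie_atlas G).
Local Notation "x * y" := (lie_mul x y).
Local Notation "x ^-1" := (lie_inv x).
Let hG := lie_groupP G.
Let hA : is_manifold A := lie_manifold hG.
Implicit Types X Y : G -> 'rV[R]_n.

Lemma tangent_idr f (i k l : chart_index A) q :
  diff_map (A := A) (B := A) f -> dom i q -> dom k (f q) -> dom l (f q) ->
  tangent i k f q *m tangent k l id (f q) = tangent i l f q.
Proof.
move=> df iq kfq lfq.
by rewrite -(tangent_comp hA hA df (diff_map_id hA) iq kfq lfq).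
Qed.

Lemma tangent_idl f (i k l : chart_index A) q :
  diff_map (A := A) (B := A) f -> dom i q -> dom k q -> dom l (f q) ->
  tangent i k id q *m tangent k l f q = tangent i l f q.
Proof.
move=> df iq kq lfq.
by rewrite -(tangent_comp hA hA (diff_map_id hA) df iq kq lfq).
Qed.

(** Left invariance is defined in preferred charts, which may jump from point to point; the chain
    rule carries it to fixed charts, usable on a whole neighbourhood. *)
Lemma field_in_mul X (j k : chart_index A) s t :
  left_invariant X -> dom j t -> dom k (s * t) ->
  field_in k X (chart k (s * t)) =
  field_in j X (chart j t) *m tangent j k (lie_mul s) t.
Proof.
move=> [_ LX] tj stk.
have {}LX : X (s * t) = X t *m
    tangent (chart_at A t) (chart_at A (s * t)) (lie_mul s) t.
  by rewrite tangent.unlock LX.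
rewrite (field_in_chart hA X stk) (field_in_chart hA X tj) LX.
rewrite -[LHS]mulmxA -[RHS]mulmxA; apply: (congr1 (mulmx _)).
have tt := chart_at_dom hA t; have stst := chart_at_dom hA (s * t).
rewrite (tangent_idl (diff_map_mull s) tt tj stk).
exact: (tangent_idr (diff_map_mull s) tt stst stk).
Qed.

(* Push-forward by inversion, which turns left-invariant fields into
   right-invariant ones. *)
Definition inv_field X (q : G) : 'rV[R]_n :=
  X q^-1 *m tangent (chart_at A q^-1) (chart_at A q) (lie_inv (l := G)) q^-1.

Lemma field_in_inv X (j k : chart_index A) q : dom j q^-1 -> dom k q ->
  field_in k (inv_field X) (chart k q) =
  field_in j X (chart j q^-1) *m tangent j k (lie_inv (l := G)) q^-1.
Proof.
move=> jq kq; rewrite (field_in_chart hA _ kq) (field_in_chart hA _ jq).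
rewrite -[LHS]mulmxA -[RHS]mulmxA; apply: (congr1 (mulmx _)).
have h1 := chart_at_dom hA q^-1; have h2 := chart_at_dom hA q.
move: (chart_at A q) h2 => i h2.
(* The point [q] is rewritten as [p^-1], so that the tangent map of inversion at [p] visibly ends at
   the right point. *)
have := lie_invgK q; move: q^-1 h1 jq => p h1 jp E; rewrite -E in h2 kq *.
rewrite (tangent_idl (diff_map_inv G) h1 jp kq).
exact: (tangent_idr (diff_map_inv G) h1 h2 kq).
Qed.

(** Inversion intertwines left translation by [t^-1] with right translation by [t]. *)
Lemma field_in_inv_mul X (i k : chart_index A) s t :
  left_invariant X -> dom i s -> dom k (s * t) ->
  field_in k (inv_field X) (chart k (s * t)) =
  field_in i (inv_field X) (chart i s) *m tangent i k (fun s => s * t) s.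
Proof.
move=> LX si stk.
have h1 := chart_at_dom hA (s * t)^-1; have h2 := chart_at_dom hA s^-1.
move: (chart_at A (s * t)^-1) (chart_at A s^-1) h1 h2 => j j' h1 h2.
rewrite (field_in_inv X h1 stk) (field_in_inv X h2 si).
rewrite lie_invMg in h1 *; rewrite (field_in_mul LX h2 h1).
rewrite -[LHS]mulmxA -[RHS]mulmxA; apply: (congr1 (mulmx _)).
have := lie_invgK s; move: s^-1 h1 h2 => p h1 h2 E; rewrite -{s}E in si stk *.
have fE : lie_inv (l := G) \o lie_mul t^-1 =1 (fun s => s * t) \o lie_inv (l := G).
  by move=> x /=; rewrite lie_invMg lie_invgK.
have stk' : dom k (t^-1 * p)^-1 by rewrite lie_invMg lie_invgK.
rewrite -(tangent_comp hA hA (diff_map_mull t^-1) (diff_map_inv G) h2 h1 stk').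
rewrite -(tangent_comp hA hA (diff_map_inv G) (diff_map_mulr t) h2 si stk).
exact: tangent_ext.
Qed.

Lemma left_invariant_smooth X : left_invariant X -> smooth_entries A X.
Proof. by move=> [sX _] i l; apply: smooth_on_entry => //; exact: range_open hA i. Qed.

(** In charts the field is the derivative of inversion along [X], evaluated at the inverse point,
    hence a composite of smooth maps. The chart around the inverse depends on the point, so the
    argument is local. *)
Lemma inv_field_smooth X : left_invariant X -> smooth_entries A (inv_field X).
Proof.
move=> /left_invariant_smooth sX i l; apply: smooth_on_local => x ix.
have [xE xi] := paramK hA ix.
pose j := chart_at A (param i x)^-1.
have jx : dom j (param i x)^-1 by exact: chart_at_dom.
exists (inv_dom i j) => //.
pose psi := chart_rep i j (lie_inv (l := G)).
have psiV y : inv_dom i j y -> inv_dom j i (psi y).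
  move=> [iy jy]; split; first exact: chart_rangeP.
  by rewrite /psi /chart_rep/= (chartK hA jy) lie_invgK; have [] := paramK hA iy.
have sd : smooth_on (inv_dom j i)
    (fun y => ('D_(field_in j X y) (chart_rep j i (lie_inv (l := G))) y) 0 l : R^o).
  apply: smooth_derive_along; [exact: open_inv_dom|exact: inv_rep_smooth|].
  by move=> k; apply: smooth_on_sub (sX j k) => y [].
have spsi k : smooth_on (inv_dom i j) (fun y => psi y 0 k : R^o).
  by apply: smooth_on_entry; [exact: open_inv_dom|exact: inv_rep_smooth].
have := smooth_on_comp (@open_inv_dom _ _ G i j) psiV sd spsi.
apply: smooth_on_ext; first exact: open_inv_dom.
move=> y; rewrite inE => Vy; have [iy jy] := Vy.
have [yE yi] := paramK hA iy.
rewrite -[in RHS]yE (field_in_inv X jy yi) /comp /psi /chart_rep/=.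
have [_ d] := diff_map_inv G.
have iy' : dom i (param i y)^-1^-1 by rewrite lie_invgK.
by rewrite (deriveEjacobian _ (d j i _ jy iy')) tangent.unlock.
Qed.

End InvariantFields.

(** * Brackets of left-invariant and right-invariant fields *)

Section InvariantBrackets.
Context {R : realType} {n : nat} (G : lieGroup R n).
Local Notation A := (lie_atlas G).
Local Notation "x * y" := (lie_mul x y).
Local Notation "x ^-1" := (lie_inv x).
Let hG := lie_groupP G.
Let hA : is_manifold A := lie_manifold hG.
Implicit Types X Y : G -> 'rV[R]_n.

Lemma tangent_inv (j k : chart_index A) p v : dom j p -> dom k p^-1 ->
  v *m tangent j k (lie_inv (l := G)) p =
  'D_v (chart_rep j k (lie_inv (l := G))) (chart j p).
Proof.
move=> jp kp; have [_ d] := diff_map_inv G.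
by rewrite (deriveEjacobian _ (d j k _ jp kp)) tangent.unlock.
Qed.

(** Inversion relates [X] to [inv_field X], so there is no sign. The usual minus sign belongs to the
    right-invariant field with the same value as [X] at the identity, which is the opposite of
    [inv_field X]. *)
Lemma bracket_inv_field X Y : left_invariant X -> left_invariant Y ->
  field_bracket A (inv_field X) (inv_field Y) = inv_field (field_bracket A X Y).
Proof.
move=> LX LY; apply/funext => q; rewrite /field_bracket/= /inv_field.
have jp := chart_at_dom hA q^-1; have kq := chart_at_dom hA q.
have := lie_invgK q.
move: (chart_at A q) kq (chart_at A q^-1) jp => k kq j; move: q^-1 => p jp E.
rewrite -{q}E in kq *; set phi := chart_rep j k (lie_inv (l := G)).
have phiE : phi (chart j p) = chart k p^-1.
  by rewrite /phi /chart_rep/= (chartK hA jp).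
have rel Z : left_invariant Z -> forall y, inv_dom j k y ->
    field_in k (inv_field Z) (phi y) = 'D_(field_in j Z y) phi y.
  move=> LZ y [jy ky]; have [yE yj] := paramK hA jy.
  have jy' : dom j (param j y)^-1^-1 by rewrite lie_invgK.
  rewrite (field_in_inv Z jy' ky) lie_invgK yE.
  by rewrite (tangent_inv _ yj ky) yE.
have yV : inv_dom j k (chart j p).
  by split; [exact: chart_rangeP|rewrite (chartK hA jp)].
rewrite (tangent_inv _ jp kq) -phiE.
apply: (bracket_related (@open_inv_dom _ _ G j k) yV); [exact: inv_rep_smooth| | | | | |].
- exact: rel.
- exact: rel.
- exact: smooth_entries_differentiable (left_invariant_smooth LX) jp.
- exact: smooth_entries_differentiable (left_invariant_smooth LY) jp.
- by rewrite phiE; exact: smooth_entries_differentiable (inv_field_smooth LX) kq.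
- by rewrite phiE; exact: smooth_entries_differentiable (inv_field_smooth LY) kq.
Qed.

(* Under multiplication (0, X) and (inv_field Y, 0) are related to X and
   inv_field Y. *)
Lemma bracket_left_invariant_inv_field X Y q : left_invariant X -> left_invariant Y ->
  field_bracket A (inv_field Y) X q = 0.
Proof.
move=> LX LY; rewrite /field_bracket/=.
have jq := chart_at_dom hA q; set j := chart_at A q in jq *.
(* Writing [q] as the product of [one] and [q] makes it the image under multiplication of the point
   [z] of the product. *)
pose one := lie_one G; pose i := chart_at A one.
have ione : dom i one by exact: chart_at_dom.
pose phi := mul_rep i j j; pose z := row_mx (chart i one) (chart j q).
have oneq : dom j (one * q) by rewrite lie_mul1g.
have zU : mul_dom i j j z.
  split; rewrite ?row_mxKl ?row_mxKr; [exact: chart_rangeP..|].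
  by rewrite (chartK hA ione) (chartK hA jq).
have phiE : phi z = chart j q.
  rewrite /phi /mul_rep row_mxKl row_mxKr (chartK hA ione) (chartK hA jq).
  by rewrite lie_mul1g.
pose X' (y : 'rV[R]_(n + n)) : 'rV[R]_(n + n) := row_mx 0 (field_in j X (rsubmx y)).
pose Y' (y : 'rV[R]_(n + n)) : 'rV[R]_(n + n) :=
  row_mx (field_in i (inv_field Y) (lsubmx y)) 0.
have relX y : mul_dom i j j y -> field_in j X (phi y) = 'D_(X' y) phi y.
  move=> [iy jy ky]; have [E1 D1] := paramK hA iy; have [E2 D2] := paramK hA jy.
  rewrite /phi /mul_rep (field_in_mul LX D2 ky) (tangent_mull _ D1 D2 ky).
  by rewrite E1 E2 hsubmxK.
have relY y : mul_dom i j j y ->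
    field_in j (inv_field Y) (phi y) = 'D_(Y' y) phi y.
  move=> [iy jy ky]; have [E1 D1] := paramK hA iy; have [E2 D2] := paramK hA jy.
  rewrite /phi /mul_rep (field_in_inv_mul LY D1 ky) (tangent_mulr _ D1 D2 ky).
  by rewrite E1 E2 hsubmxK.
have dX := smooth_entries_differentiable (left_invariant_smooth LX) jq.
have dY := smooth_entries_differentiable (inv_field_smooth LY) jq.
have dY1 := smooth_entries_differentiable (inv_field_smooth LY) ione.
have dX' : differentiable X' z.
  apply: differentiable_row_mx; first exact: differentiable_cst.
  apply: (@differentiable_comp _ _ _ _ (rsubmx : 'rV[R]_(n + n) -> 'rV[R]_n)).
    exact: differentiable_rsubmx.
  by rewrite row_mxKr.
have dY' : differentiable Y' z.
  apply: differentiable_row_mx; last exact: differentiable_cst.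
  apply: (@differentiable_comp _ _ _ _ (lsubmx : 'rV[R]_(n + n) -> 'rV[R]_n)).
    exact: differentiable_lsubmx.
  by rewrite row_mxKl.
rewrite -phiE in dX dY *.
rewrite (bracket_related (@open_mul_dom _ _ G i j j) zU (@mul_rep_smooth _ _ G i j j)
  relY relX dY' dX' dY dX).
(* [Y'] depends on the first factor only and [X'] points along the second; the other derivative
   vanishes for the mirrored reason. *)
have -> : 'D_(X' z) Y' z = 0.
  rewrite (derive_lsubmx (fun y => row_mx (field_in i (inv_field Y) y) 0)).
  have -> : lsubmx (X' z) = 0 by exact: row_mxKl.
  exact: derive0.
have -> : 'D_(Y' z) X' z = 0.
  rewrite (derive_rsubmx (fun y => row_mx 0 (field_in j X y))).
  have -> : rsubmx (Y' z) = 0 by exact: row_mxKr.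
  exact: derive0.
rewrite subrr; exact: derive0.
Qed.

(** Inversion is an involution, so its tangent map is undone by its tangent map at the image
    point. *)
Lemma inv_field_neq0 X q : X q^-1 != 0 -> inv_field X q != 0.
Proof.
apply: contraNN => /eqP; rewrite /inv_field.
have jp := chart_at_dom hA q^-1; have kq := chart_at_dom hA q.
have := lie_invgK q.
move: (chart_at A q) kq (chart_at A q^-1) jp => k kq j; move: q^-1 => p jp E.
rewrite -{q}E in kq *.
have jp' : dom j p^-1^-1 by rewrite lie_invgK.
have id_ext : lie_inv (l := G) \o lie_inv (l := G) =1 id by exact: lie_invgK.
move=> /(congr1 (mulmxr (tangent k j (lie_inv (l := G)) p^-1))).
rewrite /= mul0mx -mulmxA -(tangent_comp hA hA (diff_map_inv G) (diff_map_inv G) jp kq jp').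
by rewrite (tangent_ext _ _ _ id_ext) (tangent_id hA jp) mulmx1 => ->.
Qed.

End InvariantBrackets.

(** * Hamiltonian calculus on the cotangent bundle *)

Section Differentials.
Context {R : realType} {m : nat} {P : Type}.
Variable A : atlas R m P.
Implicit Types (F K : P -> R) (p : P).

Definition diff_fun F p := differentiable
  (F \o param (chart_at A p) : 'rV[R]_m -> R^o) (chart (chart_at A p) p).

Lemma derive_differential F p v : diff_fun F p ->
  'D_v (F \o param (chart_at A p) : _ -> R^o) (chart (chart_at A p) p) =
  (v *m (differential A F p)^T) 0 0.
Proof.
move=> dF; rewrite (derive_coord_mul _ dF) mxE.
by apply: eq_bigr => l _; rewrite !mxE.
Qed.

Lemma differentialD F K p : diff_fun F p -> diff_fun K p ->
  differential A (fun l => F l + K l) p = differential A F p + differential A K p.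
Proof.
move=> dF dK; apply/rowP => l; rewrite !mxE.
exact: (deriveD (diff_derivable dF) (diff_derivable dK)).
Qed.

Lemma differentialM F K p :
  param (chart_at A p) (chart (chart_at A p) p) = p ->
  diff_fun F p -> diff_fun K p ->
  differential A (fun l => F l * K l) p =
  F p *: differential A K p + K p *: differential A F p.
Proof.
move=> pK dF dK; apply/rowP => l; rewrite !mxE.
rewrite [LHS](deriveM_mul _ dF dK)/= pK.
have aux (a b c d : R) : a * b + c * d = c * d + b * a by ring.
exact: aux.
Qed.

Lemma differentialZ (c : R) F p : diff_fun F p ->
  differential A (fun l => c * F l) p = c *: differential A F p.
Proof.
move=> dF; apply/rowP => l; rewrite !mxE.
exact: (deriveZ c (diff_derivable dF)).
Qed.

Lemma smooth_fun_diff F p : (chart_range (chart_at A p)) (chart (chart_at A p) p) ->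
  smooth_fun A F -> diff_fun F p.
Proof. by move=> h sF; exact: (smooth_on_differentiable (sF _) h). Qed.

Section SmoothAlgebra.
Hypothesis oA : forall i : chart_index A, open (chart_range i).

Lemma smooth_funD F K : smooth_fun A F -> smooth_fun A K ->
  smooth_fun A (fun l => F l + K l).
Proof. by move=> sF sK i; exact: (smooth_onD (@oA i) (sF i) (sK i)). Qed.

Lemma smooth_funM F K : smooth_fun A F -> smooth_fun A K ->
  smooth_fun A (fun l => F l * K l).
Proof. by move=> sF sK i; exact: (smooth_onM (@oA i) (sF i) (sK i)). Qed.

Lemma smooth_fun_cst (c : R) : smooth_fun A (fun=> c).
Proof. by move=> i; exact: smooth_on_cst. Qed.

Lemma smooth_funZ (c : R) F : smooth_fun A F -> smooth_fun A (fun l => c * F l).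
Proof. by move=> sF; apply: smooth_funM => //; exact: smooth_fun_cst. Qed.

End SmoothAlgebra.

Lemma velocity_is_derive F (gam : R -> P) t v :
  (forall p i, dom i p -> param i (chart (a := A) i p) = p) ->
  diff_fun F (gam t) -> velocity A gam t v ->
  is_derive (t : R^o) 1 (F \o gam : _ -> R^o)
    ((v *m (differential A F (gam t))^T) 0 0).
Proof.
move=> chK dF [near_dom gamv]; set i := chart_at A (gam t) in near_dom gamv.
have dg : differentiable (chart i \o gam : R^o -> 'rV[R]_m) t.
  by apply/derivable1_diffP; have [] := gamv.
apply: (@near_eq_is_derive _ _ _ ((F \o param i) \o (chart i \o gam))).
  by apply: filterS near_dom => s si /=; rewrite chK.
apply: DeriveDef.
  by apply: diff_derivable; exact: (differentiable_comp dg dF).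
rewrite (derive_comp _ dg dF) -derive_differential//.
by rewrite (@derive_val _ _ _ _ _ _ _ gamv).
Qed.

End Differentials.

Section SymplecticForm.
Context {R : realType} {n : nat}.
Implicit Types a b c : 'rV[R]_(n + n).

(** The Poisson bivector on covectors of the cotangent bundle: with halves (x, p) it is a_p . b_x -
    a_x . b_p. It turns [poisson] into bilinear algebra on differentials. *)
Definition omega a b : R := (row_mx (rsubmx a) (- lsubmx a) *m b^T) 0 0.

Lemma omegaE a b : omega a b =
  (rsubmx a *m (lsubmx b)^T) 0 0 - (lsubmx a *m (rsubmx b)^T) 0 0.
Proof.
rewrite /omega -{1}(hsubmxK b) tr_row_mx mul_row_col mulNmx mxE.
by congr (_ + _); rewrite mxE.
Qed.

Lemma omegaDl a b c : omega (a + b) c = omega a c + omega b c.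
Proof.
rewrite !omegaE !linearD/= !mulmxDl.
have aux (x y z t : R) : x + y - (z + t) = x - z + (y - t) by ring.
by rewrite -aux; congr (_ - _); rewrite mxE.
Qed.

Lemma omegaZl k a b : omega (k *: a) b = k * omega a b.
Proof.
rewrite !omegaE !linearZ/= -!scalemxAl mulrBr.
by congr (_ - _); rewrite mxE.
Qed.

Lemma omegaC a b : omega a b = - omega b a.
Proof.
rewrite !omegaE opprB; congr (_ - _).
  by rewrite -[in LHS](trmxK (rsubmx a)) -trmx_mul mxE.
by rewrite -[in LHS](trmxK (lsubmx a)) -trmx_mul mxE.
Qed.

Lemma omegaDr a b c : omega a (b + c) = omega a b + omega a c.
Proof. by rewrite omegaC omegaDl opprD -!omegaC. Qed.

Lemma omegaZr k a b : omega a (k *: b) = k * omega a b.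
Proof. by rewrite omegaC omegaZl -mulrN -omegaC. Qed.

Definition omega_bilinear := (omegaDl, omegaDr, omegaZl, omegaZr).

Lemma omega_self a : omega a a = 0.
Proof. by have := omegaC a a => /eqP; rewrite -addr_eq0 -mulr2n mulrn_eq0 => /eqP. Qed.

End SymplecticForm.

Section Cotangent.
Context {R : realType} {n : nat} {M : topologicalType} {A : atlas R n M}.
Hypothesis hA : is_manifold A.
Local Notation TA := (cotangent_atlas A).
Implicit Types (X Y : M -> 'rV[R]_n) (lam : cotangent R n M).

Lemma cotangent_chartE (i : chart_index TA) lam :
  chart i lam = row_mx (chart (a := A) i lam.1)
    (lam.2 *m (tangent (A := A) (B := A) i (chart_at A lam.1) id lam.1)^T).
Proof. by rewrite tangent.unlock. Qed.

Lemma cotangent_paramE (i : chart_index TA) z :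
  param i z = let q := param (a := A) i (lsubmx z) in
    (q, rsubmx z *m (tangent (A := A) (B := A) (chart_at A q) i id q)^T).
Proof. by rewrite tangent.unlock. Qed.

Lemma cotangent_chartK (i : chart_index TA) lam : dom i lam -> param i (chart i lam) = lam.
Proof.
case: lam => q p ilam; have iq : dom (a := A) i q := ilam.
have aq := chart_at_dom hA q.
rewrite cotangent_chartE cotangent_paramE/= row_mxKl row_mxKr (chartK hA iq).
congr (_, _); rewrite -mulmxA -trmx_mul.
by rewrite (tangent_idK hA aq iq) trmx1 mulmx1.
Qed.

Lemma cotangent_rangeE (i : chart_index TA) :
  chart_range i = [set z | chart_range (A := A) i (lsubmx z)].
Proof.
apply/seteqP; split=> [z [lam ilam <-]|z /= iz].
  by rewrite /= row_mxKl; exact: chart_rangeP.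
have [zE zi] := paramK hA iz; exists (param i z) => //.
have aq := chart_at_dom hA (param (a := A) i (lsubmx z)).
rewrite cotangent_chartE cotangent_paramE/= zE -mulmxA -trmx_mul.
by rewrite (tangent_idK hA zi aq) trmx1 mulmx1 hsubmxK.
Qed.

Lemma cotangent_range_open (i : chart_index TA) : open (chart_range i).
Proof.
rewrite cotangent_rangeE openE => z iz.
exact: (continuous_lsubmx (near_range hA iz)).
Qed.

Lemma cotangent_chart_at lam : chart (chart_at TA lam) lam =
  row_mx (chart (chart_at A lam.1) lam.1) lam.2.
Proof.
by rewrite cotangent_chartE (tangent_id hA (chart_at_dom hA _)) trmx1 mulmx1.
Qed.

Lemma cotangent_at_dom lam : dom (chart_at TA lam) lam.
Proof. exact: chart_at_dom hA lam.1. Qed.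

Lemma cotangent_at_range lam :
  chart_range (chart_at TA lam) (chart (chart_at TA lam) lam).
Proof. by exists lam => //; exact: cotangent_at_dom. Qed.

Lemma pairing_param (i : chart_index TA) X z :
  pairing X (param i z) = (rsubmx z *m (field_in (A := A) i X (lsubmx z))^T) 0 0.
Proof.
by rewrite cotangent_paramE /pairing/= /field_in -mulmxA -trmx_mul tangent.unlock.
Qed.

Lemma smooth_fun_pairing X : smooth_entries A X -> smooth_fun TA (pairing X).
Proof.
move=> sX i.
have oU := @cotangent_range_open i; have UE := cotangent_rangeE i.
have H : smooth_on (chart_range (A := TA) i) (fun z => \sum_k z 0 (rshift n k) *
    field_in (A := A) i X (lsubmx z) 0 k : R^o).
  apply: smooth_on_sum => // k; apply: smooth_onM => //; first exact: smooth_on_coord.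
  apply: (smooth_on_comp (V := chart_range (A := A) i) oU _ (sX i k)).
    by move=> z; rewrite UE.
  move=> l; under eq_fun do rewrite mxE.
  exact: smooth_on_coord.
apply: smooth_on_ext H => // z _.
by rewrite /= pairing_param mxE; apply: eq_bigr => k _; rewrite !mxE.
Qed.

Lemma diff_fun_smooth F lam : smooth_fun TA F -> diff_fun TA F lam.
Proof. by move=> sF; apply: smooth_fun_diff => //; exact: cotangent_at_range. Qed.

Lemma derive_mulmx_const (f : 'rV[R]_n -> 'rV[R]_n) (p x v : 'rV[R]_n) :
  differentiable f x ->
  'D_v (fun y => (p *m (f y)^T) 0 0 : R^o) x = (p *m ('D_v f x)^T) 0 0.
Proof.
move=> df.
transitivity ('D_v (\sum_k (fun y => p 0 k *: (f y 0 k : R^o))) x).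
  congr ('D_v _ x); apply/funext => y; rewrite fct_sumE mxE.
  by apply: eq_bigr => k _; rewrite mxE.
have dk k : derivable (fun y => f y 0 k : R^o) x v.
  exact/diff_derivable/differentiable_entry.
rewrite derive_sum; last by move=> k; exact: derivableZ.
rewrite mxE; apply: eq_bigr => k _.
by rewrite deriveZ// mxE (derive_entry _ (diff_derivable df)).
Qed.

Lemma differential_pairing_lsub X lam v : smooth_entries A X ->
  (v *m (lsubmx (differential TA (pairing X) lam))^T) 0 0 =
  (lam.2 *m ('D_v (field_in (chart_at A lam.1) X) (chart (chart_at A lam.1) lam.1))^T) 0 0.
Proof.
move=> sX; have dX := diff_fun_smooth lam (smooth_fun_pairing sX).
have := derive_differential (row_mx v 0) dX.
rewrite -{1}[differential _ _ _]hsubmxK tr_row_mx mul_row_col mul0mx addr0 => <-.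
rewrite cotangent_chart_at -derive_row_mxl.
rewrite -derive_mulmx_const; last first.
  exact: smooth_entries_differentiable sX (chart_at_dom hA lam.1).
have -> : (fun y => (pairing X \o param (chart_at TA lam)) (row_mx y lam.2)) =
    (fun y => (lam.2 *m (field_in (chart_at A lam.1) X y)^T) 0 0).
  by apply/funext => y; rewrite /comp pairing_param row_mxKl row_mxKr.
by [].
Qed.

Lemma differential_pairing_rsub X lam : smooth_entries A X ->
  rsubmx (differential TA (pairing X) lam) = X lam.1.
Proof.
move=> sX; have dX := diff_fun_smooth lam (smooth_fun_pairing sX).
apply/rowP => k.
have := derive_differential (row_mx 0 (delta_mx 0 k)) dX.
rewrite -{1}[differential _ _ _]hsubmxK tr_row_mx mul_row_col mul0mx add0r.
rewrite -rowE !mxE => <-.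
rewrite cotangent_chart_at -derive_row_mxr.
have -> : (fun y => (pairing X \o param (chart_at TA lam))
    (row_mx (chart (chart_at A lam.1) lam.1) y)) =
    (fun y : 'rV[R]_n => (X lam.1 *m y^T) 0 0).
  apply/funext => y; rewrite /comp pairing_param row_mxKl row_mxKr.
  rewrite (field_in_chart_at hA) -[in RHS](trmxK (X _)) -trmx_mul.
  by rewrite [RHS]mxE.
rewrite (derive_mulmx_const (f := id))// derive_id trmx_delta -colE !mxE//.
Qed.

(** The fibre half of the differential of [pairing X] is [X], and its base half is the covector
    applied to the derivative of [X]. The two terms of [omega] are thus the covector applied to the
    two terms of the bracket. *)
Lemma omega_pairing X Y lam : smooth_entries A X -> smooth_entries A Y ->
  omega (differential TA (pairing X) lam) (differential TA (pairing Y) lam) =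
  pairing (field_bracket A X Y) lam.
Proof.
move=> sX sY; rewrite omegaE !differential_pairing_rsub//.
rewrite differential_pairing_lsub//.
have -> : (lsubmx (differential TA (pairing X) lam) *m (Y lam.1)^T) 0 0 =
    (Y lam.1 *m (lsubmx (differential TA (pairing X) lam))^T) 0 0.
  by rewrite -[in LHS](trmxK (lsubmx _)) -trmx_mul mxE.
rewrite differential_pairing_lsub//.
rewrite /pairing /field_bracket/= !(field_in_chart_at hA) linearB/= mulmxBr.
by rewrite [RHS]mxE; congr (_ + _); rewrite [RHS]mxE.
Qed.

Lemma poissonE F K lam :
  poisson A F K lam = omega (differential TA F lam) (differential TA K lam).
Proof. by []. Qed.

Lemma is_derive_along_curve F (gam : R -> cotangent R n M) t v :
  smooth_fun TA F -> velocity TA gam t v ->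
  is_derive (t : R^o) 1 (F \o gam : _ -> R^o)
    ((v *m (differential TA F (gam t))^T) 0 0).
Proof.
move=> sF; apply: velocity_is_derive; last exact: diff_fun_smooth.
by move=> lam i; exact: cotangent_chartK.
Qed.

(** Along the flow the derivative of [F] is its Poisson bracket with [H]; the mean value theorem
    turns a zero derivative into constancy. *)
Lemma first_integralP H F : smooth_fun TA F -> poisson_commute A H F ->
  first_integral A H F.
Proof.
move=> sF HF; split=> // a b lam lamH.
have fD t : t \in `]a, b[ -> is_derive (t : R^o) 1 (F \o lam : _ -> R^o) 0.
  move=> /lamH /(is_derive_along_curve sF).
  by rewrite [X in is_derive _ _ _ X](HF (lam t)).
suff lt_cst s t : s \in `]a, b[ -> t \in `]a, b[ -> s < t -> F (lam s) = F (lam t).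
  by move=> s t sab tab; have [st|ts|->//] := ltgtP s t; [|apply: esym]; exact: lt_cst.
rewrite !in_itv/= => /andP[sa sb] /andP[ta tb] st.
have sub x : x \in `[s, t] -> x \in `]a, b[.
  by rewrite !in_itv/= => /andP[sx xt]; rewrite (lt_le_trans sa)//= (le_lt_trans xt).
pose f : R -> R := F \o lam.
have fDo x : x \in `]s, t[ -> is_derive (x : R^o) 1 f 0.
  by move=> xst; apply/fD/sub; exact: subset_itv_oo_cc xst.
have fc : {within `[s, t], continuous f}.
  apply: derivable_within_continuous => x /sub/fD d.
  exact: (@ex_derive _ _ _ _ _ _ _ d).
have [c _] := MVT st fDo fc.
by rewrite mul0r => /eqP; rewrite subr_eq0 => /eqP.
Qed.

End Cotangent.

(** * Null sets *)

Section NullSets.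
Context {R : realType}.

Lemma ler_sum_uniq (I : eqType) (s s' : seq I) (F : I -> R) :
  uniq s -> uniq s' -> {subset s <= s'} -> (forall i, 0 <= F i) ->
  \sum_(i <- s) F i <= \sum_(i <- s') F i.
Proof.
move=> us us' ss' F0; rewrite [leRHS](bigID [in s])/= -[X in _ <= X + _]big_filter.
have ps : perm_eq [seq i <- s' | [in s] i] s.
  apply: uniq_perm => //; first exact: filter_uniq.
  by move=> x; rewrite mem_filter /=; case: (boolP (x \in s)) => //= /ss'.
by rewrite (perm_big _ ps) lerDl sumr_ge0.
Qed.

Context {m : nat}.
Hypothesis m0 : (0 < m)%N.

Definition box (lo hi : 'rV[R]_m) : set 'rV[R]_m :=
  [set x | forall l, lo 0 l <= x 0 l <= hi 0 l].
Definition box_volume (lo hi : 'rV[R]_m) : R := \prod_(l < m) (hi 0 l - lo 0 l).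

Lemma null_set_subset (S T : set 'rV[R]_m) : S `<=` T -> null_set T -> null_set S.
Proof.
move=> ST nT e /nT[lo [hi [lohi Tc ve]]]; exists lo, hi; split=> //.
exact: subset_trans ST Tc.
Qed.

Lemma box_volume_ge0 (lo hi : 'rV[R]_m) :
  (forall l, lo 0 l <= hi 0 l) -> 0 <= box_volume lo hi.
Proof. by move=> lohi; apply: prodr_ge0 => l _; rewrite subr_ge0. Qed.

Lemma box_volume0 (x : 'rV[R]_m) : box_volume x x = 0.
Proof. by rewrite /box_volume (bigD1 (Ordinal m0))//= subrr mul0r. Qed.

(** Bounding sums over finite duplicate-free lists makes the condition independent of any
    enumeration of the boxes. *)
Lemma null_set_cover (S : set 'rV[R]_m) :
  (forall e : R, 0 < e -> exists (T : countType) (lo hi : T -> 'rV[R]_m),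
    [/\ forall t l, lo t 0 l <= hi t 0 l,
        S `<=` \bigcup_t box (lo t) (hi t)
      & forall s : seq T, uniq s ->
          \sum_(t <- s) box_volume (lo t) (hi t) <= e]) ->
  null_set S.
Proof.
move=> H e /H[T [lo [hi [lohi Sc ve]]]].
(* Numbers that code no element of [T] receive the degenerate box at 0, of volume 0 since the
   dimension is positive. *)
exists (fun k => if pickle_inv k is Some t then lo t else 0).
exists (fun k => if pickle_inv k is Some t then hi t else 0).
split=> [k l|x /Sc[t _ xt]|N].
- by case: (pickle_inv k).
- by exists (pickle t) => //; rewrite pickleK_inv.
- pose s := pmap (pickle_inv (T := T)) (iota 0 N).
  apply: le_trans (ve s _); last by rewrite (pmap_uniq (@pickle_invK T)) ?iota_uniq.
  pose v k := box_volume (if pickle_inv k is Some t then lo t else 0)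
    (if pickle_inv k is Some t then hi t else 0).
  rewrite -[leLHS]/(\sum_(k < N) v k) -(big_mkord xpredT v) /s big_pmap /v.
  rewrite /index_iota subn0 le_eqVlt; apply/orP; left; apply/eqP.
  apply: eq_bigr => k _; case: (pickle_inv k) => //=.
  exact: box_volume0.
Qed.

Lemma sum_geometric_half (e : R) N : \sum_(j < N) e / 2 ^+ j.+1 = e - e / 2 ^+ N.
Proof.
elim: N => [|N IH]; first by rewrite big_ord0 expr0 divr1 subrr.
rewrite big_ord_recr/= IH exprS; field.
by rewrite expf_neq0// pnatr_eq0.
Qed.

Lemma null_set0 : null_set (set0 : set 'rV[R]_m).
Proof.
apply: null_set_cover => e e0; exists void, (fun=> 0), (fun=> 0).
by split=> // -[|[]//] _; rewrite big_nil ltW.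
Qed.

Lemma null_set_bigcup (S : nat -> set 'rV[R]_m) :
  (forall k, null_set (S k)) -> null_set (\bigcup_k S k).
Proof.
move=> nS; apply: null_set_cover => e e0.
have ek k : 0 < e / 2 ^+ k.+1 by rewrite divr_gt0// exprn_gt0.
have /choice[lohi P] : forall k, exists lh : (nat -> 'rV[R]_m) * (nat -> 'rV[R]_m),
    [/\ forall t l, lh.1 t 0 l <= lh.2 t 0 l,
        S k `<=` \bigcup_t box (lh.1 t) (lh.2 t)
      & forall N, \sum_(t < N) box_volume (lh.1 t) (lh.2 t) <= e / 2 ^+ k.+1].
  by move=> k; have [lo [hi ?]] := nS k _ (ek k); exists (lo, hi).
exists (nat * nat)%type, (fun t => (lohi t.1).1 t.2), (fun t => (lohi t.1).2 t.2).
split=> [t l|x [k _]|s us].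
- by have [+ _ _] := P t.1; exact.
- by have [_ + _] := P k => /[apply] -[t _ xt]; exists (k, t).
- have [N sN] : exists N, forall j t, (j, t) \in s -> (maxn j t < N)%N.
    exists (\max_(t <- s) maxn t.1 t.2).+1 => j t jts; rewrite ltnS.
    exact: (@leq_bigmax_seq _ s xpredT (fun t => maxn t.1 t.2) _ jts).
  (* A finite list of pairs lies in a square, where the sum is taken row by row, the row [j] costing
     at most [e / 2 ^+ j.+1]. *)
  pose s' := [seq (j, t) | j <- index_iota 0 N, t <- index_iota 0 N].
  have ss' : {subset s <= s'}.
    move=> [j t] /sN; rewrite gtn_max => /andP[jN tN].
    by apply/allpairsP; exists (j, t); split; rewrite ?mem_index_iota.
  have us' : uniq s'.
    by apply: allpairs_uniq; rewrite ?iota_uniq// => -[? ?] [? ?].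
  have v0 (t : nat * nat) : 0 <= box_volume ((lohi t.1).1 t.2) ((lohi t.1).2 t.2).
    by apply: box_volume_ge0 => l; have [+ _ _] := P t.1; exact.
  apply: le_trans (ler_sum_uniq us us' ss' v0) _.
  rewrite big_allpairs/=.
  apply: (@le_trans _ _ (\sum_(j < N) e / 2 ^+ j.+1)).
    rewrite big_mkord; apply: ler_sum => j _; rewrite big_mkord.
    by have [_ _] := P j; exact.
  by rewrite sum_geometric_half lerBlDr lerDl divr_ge0 ?exprn_ge0// ltW.
Qed.

Lemma null_set_bigcup_count (I : countType) (S : I -> set 'rV[R]_m) :
  (forall i, null_set (S i)) -> null_set (\bigcup_i S i).
Proof.
move=> nS; apply: (@null_set_subset _
  (\bigcup_k if pickle_inv k is Some i then S i else set0)).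
  by move=> x [i _ Six]; exists (pickle i) => //; rewrite pickleK_inv.
apply: null_set_bigcup => k; case: (pickle_inv k) => [i|].
  exact: nS.
exact: null_set0.
Qed.

Lemma null_set_union (S T : set 'rV[R]_m) : null_set S -> null_set T -> null_set (S `|` T).
Proof.
move=> nS nT; apply: (@null_set_subset _ (\bigcup_(b : bool) if b then S else T)).
  by move=> x [Sx|Tx]; [exists true|exists false].
by apply: null_set_bigcup_count => -[].
Qed.

Lemma mx_norm_ltP (x : 'rV[R]_m) (r : R) : 0 < r ->
  `|x| < r <-> forall l, `|x 0 l| < r.
Proof.
move=> r0; rewrite /Num.Def.normr/= mx_normrE; split.
  by move=> /bigmax_ltP[_ H] l; exact: (H (0, l)).
by move=> H; apply/bigmax_ltP; split=> // -[i l] _; rewrite /= ord1; exact: H.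
Qed.

Lemma mx_norm_leP (x : 'rV[R]_m) (r : R) : 0 <= r ->
  `|x| <= r <-> forall l, `|x 0 l| <= r.
Proof.
move=> r0; rewrite /Num.Def.normr/= mx_normrE; split.
  by move=> /bigmax_leP[_ H] l; exact: (H (0, l)).
by move=> H; apply/bigmax_leP; split=> // -[i l] _; rewrite /= ord1; exact: H.
Qed.

(* Lindelof, through the countably many balls with rational centre and radius. *)
Lemma null_set_local (S : set 'rV[R]_m) :
  (forall z, S z -> exists2 r : R, 0 < r &
     null_set (S `&` [set y | `|y - z| <= r])) -> null_set S.
Proof.
move=> H.
pose Q (i : 'rV[rat]_m * rat) : set 'rV[R]_m :=
  S `&` [set y | `|y - map_mx ratr i.1| < ratr i.2].
(* Only the rational balls meeting [S] in a null set are kept. A radius below [r / 2], with centre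
   closer to [z] than that radius, places such a ball inside the given one. *)
pose Q' i := if `[< null_set (Q i) >] then Q i else set0.
apply: (@null_set_subset _ (\bigcup_i Q' i)); last first.
  apply: null_set_bigcup_count => i; rewrite /Q'.
  by case: asboolP => // _; exact: null_set0.
move=> z Sz; have [r r0 nr] := H z Sz.
have /rat_in_itvoo[q] : 0 < r / 2 by rewrite divr_gt0.
rewrite in_itv/= => /andP[q0 qr].
have /choice[c Pc] : forall l : 'I_m, exists c : rat, `|z 0 l - ratr c| < ratr q.
  move=> l; have /rat_in_itvoo[c] : z 0 l - ratr q < z 0 l + ratr q.
    by rewrite ltrD2l gtrN.
  rewrite in_itv/= => /andP[c1 c2]; exists c.
  by rewrite ltr_distlC c1 c2.
have zc : `|z - map_mx ratr (\row_l c l)| < ratr q.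
  by apply/mx_norm_ltP => // l; rewrite !mxE.
exists (\row_l c l, q) => //; rewrite /Q'; case: asboolP => [_|[]]; first by split.
apply: (null_set_subset _ nr) => y [Sy /= yc]; split=> //=.
rewrite (_ : y - z = (y - map_mx ratr (\row_l c l)) - (z - map_mx ratr (\row_l c l))).
  rewrite (le_trans (ler_normB _ _))// (le_trans (lerD (ltW yc) (ltW zc)))//.
  by rewrite [leRHS](splitr r) lerD// ltW.
by rewrite opprB addrA subrK.
Qed.

End NullSets.

(** * Zero sets of functions that vary at a definite rate in one coordinate *)

Section Hypersurface.
Context {R : realType}.

(** The least [i] whose right end is beyond [t] works: minimality puts the left end before [t], and
    for [i] equal to 0 the left end is [a]. *)
Lemma grid_cell (a w t : R) N : 0 <= w -> a <= t <= a + w ->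
  exists i : 'I_N.+1, a + w * (i%:R / N.+1%:R) <= t <= a + w * (i.+1%:R / N.+1%:R).
Proof.
move=> w0 /andP[ta tw].
have ex : exists i, t <= a + w * (i.+1%:R / N.+1%:R).
  by exists N; rewrite divff ?pnatr_eq0// mulr1.
have iN : (ex_minn ex < N.+1)%N.
  case: ex_minnP => i _; rewrite ltnS; apply.
  by rewrite divff ?pnatr_eq0// mulr1.
exists (Ordinal iN) => /=; case: ex_minnP iN => -[|i] ti imin _; rewrite ti andbT.
  by rewrite mul0r mulr0 addr0.
rewrite leNgt; apply/negP => it.
by have := imin i (ltW it); rewrite ltnn.
Qed.

Context {m : nat}.

Lemma compact_cube (z : 'rV[R]_m) (r : R) : 0 < r -> compact [set y | `|y - z| <= r].
Proof.
move=> r0.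
have cI (i : 'I_m) : compact `[z 0 i - r, z 0 i + r]%classic.
  exact: segment_compact.
rewrite (_ : [set y | _] =
    [set v : 'rV[R]_m | forall i, `[z 0 i - r, z 0 i + r]%classic (v ord0 i)]).
  exact: (rV_compact cI).
apply/seteqP; split=> y /=.
  move=> /(mx_norm_leP _ (ltW r0)) H i; have := H i.
  by rewrite !mxE ler_distl in_itv/=.
move=> H; apply/(mx_norm_leP _ (ltW r0)) => i; have := H i.
by rewrite !mxE ler_distl in_itv/=.
Qed.

(** Heine-Cantor on a closed cube, with the modulus expressed as [2 * r / N.+1%:R], the mesh of the
    grid used below. *)
Lemma uniform_cube (f : 'rV[R]_m -> R) (z : 'rV[R]_m) (r w : R) : 0 < r -> 0 < w ->
  (forall y, `|y - z| <= r -> {for y, continuous f}) ->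
  exists N : nat, forall y y', `|y - z| <= r -> `|y' - z| <= r ->
    `|y - y'| <= 2 * r / N.+1%:R -> `|f y - f y'| <= w.
Proof.
move=> r0 w0 cf.
have w20 : 0 < w / 2 by rewrite divr_gt0.
pose P (N : nat) (y : 'rV[R]_m) := forall y', `|y' - z| <= r ->
  `|y - y'| <= 2 * r / N.+1%:R -> `|f y - f y'| <= w.
have cover x : `|x - z| <= r -> \forall x' \near x & N \near \oo, P N x'.
  move=> /cf /cvgrPdist_lt /(_ _ w20) /nbhs_ballP[d /= d0 Hd].
  have d20 : 0 < d / 2 by rewrite divr_gt0.
  exists ([set y | `|x - y| < d / 2], [set N : nat | 2 * r / N.+1%:R < d / 2]).
    split=> /=.
      by apply/nbhs_ballP; exists (d / 2) => //= y; rewrite -ball_normE.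
    have p : 0 < d / 2 / (2 * r) by rewrite divr_gt0// mulr_gt0.
    have := near_infty_natSinv_lt (PosNum p); apply: filterS => N /=.
    by rewrite ltr_pdivlMr ?mulr_gt0// mulrC.
  move=> [y N] /= [xy Nd] y' _ yy'.
  have H1 : `|f x - f y| < w / 2.
    by apply: Hd; rewrite -ball_normE/= (lt_le_trans xy)// ler_pdivrMr// ler_peMr ?ler1n// ltW.
  have H2 : `|f x - f y'| < w / 2.
    apply: Hd; rewrite -ball_normE/= -(subrKA y) (le_lt_trans (ler_normD _ _))//.
    by rewrite [ltRHS]splitr ltrD// (le_lt_trans yy').
  rewrite distrC in H1; rewrite -(subrKA (f x)) (le_trans (ler_normD _ _))//.
  by rewrite [leRHS]splitr lerD// ltW.
have /compact_near_coveringP Cz := compact_cube (z := z) r0.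
have [N _ H] := Cz nat \oo P _ cover.
by exists N => y y' yz; exact: (H N (leqnn N) y yz y').
Qed.

(* Over each cell of a fine grid in the coordinates other than k, the k-th
   coordinate of the points of S varies by at most eta. *)
Lemma null_set_hypersurface (S : set 'rV[R]_m) (f : 'rV[R]_m -> R)
    (z : 'rV[R]_m) (r d : R) (k : 'I_m) :
  0 < r -> 0 < d ->
  (forall y, `|y - z| <= r -> {for y, continuous f}) ->
  (forall y, S y -> `|y - z| <= r -> f y = 0) ->
  (forall y y', `|y - z| <= r -> `|y' - z| <= r ->
     (forall l, l != k -> y 0 l = y' 0 l) ->
     d * `|y 0 k - y' 0 k| <= `|f y - f y'|) ->
  null_set (S `&` [set y | `|y - z| <= r]).
Proof.
move=> r0 d0 cf f0 fk; apply: null_set_cover => [|e e0].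
  exact: leq_ltn_trans (leq0n k) (ltn_ord k).
have r20 : 0 < 2 * r by rewrite mulr_gt0.
pose W : R := \prod_(l < m | l != k) (2 * r).
have W0 : 0 < W by apply: prodr_gt0.
(* With this height each box has volume [e] divided by the number of boxes, so the total is exactly
   [e]. *)
pose eta := e / W; have eta0 : 0 < eta by rewrite divr_gt0.
(* An oscillation of at most [eta * d / 2] across a cell becomes, after division by the rate [d], a
   spread of at most [eta / 2] in the coordinate [k]. *)
have [N HN] := uniform_cube r0 (divr_gt0 (mulr_gt0 eta0 d0) (ltr0Sn _ 1)) cf.
have N0 : 0 < N.+1%:R :> R by rewrite ltr0n.
pose T := {ffun 'I_m -> 'I_N.+1}.
pose left (g : T) l : R := z 0 l - r + 2 * r * ((g l)%:R / N.+1%:R).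
pose right (g : T) l : R := z 0 l - r + 2 * r * ((g l).+1%:R / N.+1%:R).
pose E (g : T) := [set y | [/\ S y, `|y - z| <= r
  & forall l, l != k -> left g l <= y 0 l <= right g l]].
(* The slab over a cell is centred at a chosen point of [S]; over an empty cell [get] returns some
   default point, which is harmless. [E g] does not see [g k], which numbers the pieces into which
   the slab is cut. *)
pose c (g : T) := get (E g) 0 k - eta / 2.
pose lo (g : T) := \row_l if l == k then c g + eta * ((g k)%:R / N.+1%:R) else left g l.
pose hi (g : T) := \row_l if l == k then c g + eta * ((g k).+1%:R / N.+1%:R) else right g l.
have widthE (a w : R) i : a + w * (i.+1%:R / N.+1%:R) - (a + w * (i%:R / N.+1%:R)) =
    w / N.+1%:R.
  by rewrite -natr1; field; rewrite gt_eqF.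
have lohi g l : lo g 0 l <= hi g 0 l.
  rewrite !mxE -subr_ge0; case: eqP => _; rewrite widthE divr_ge0 ?ltW//.
have volE g : box_volume (lo g) (hi g) = e / (#|{: T}|)%:R.
  rewrite /box_volume (eq_bigr (fun l => (if l == k then eta else 2 * r) * N.+1%:R^-1)).
    rewrite big_split/= prodr_const (bigD1 k)//= eqxx.
    rewrite (eq_bigr (fun=> 2 * r)); last by move=> l /negbTE ->.
    rewrite -/W /eta mulfVK ?gt_eqF// card_ffun !card_ord exprVn natrX.
    by [].
  by move=> l _; rewrite !mxE; case: eqP => _; rewrite widthE.
exists T, lo, hi; split=> // [y [Sy yz]|s us]; last first.
  apply: (@le_trans _ _ (\sum_(g : T) box_volume (lo g) (hi g))).
    apply: (ler_sum_uniq us (index_enum_uniq T)) => [g _|g].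
      by rewrite mem_index_enum.
    by rewrite -[X in 0 <= X]/(box_volume (lo g) (hi g)) volE divr_ge0// ltW.
  rewrite (eq_bigr _ (fun g _ => volE g)) sumr_const -[leLHS]mulr_natr.
  rewrite divfK// pnatr_eq0 -lt0n; apply/card_gt0P.
  by exists [ffun=> ord0].
have yl l : z 0 l - r <= y 0 l <= z 0 l - r + 2 * r.
  have /(mx_norm_leP _ (ltW r0))/(_ l) := yz.
  rewrite !mxE ler_distl => /andP[-> H]; rewrite (le_trans H)//.
  by rewrite le_eqVlt; apply/orP; left; apply/eqP; ring.
have /choice[g0 Hg0] := fun l => grid_cell N (ltW r20) (yl l).
pose g1 : T := [ffun l => g0 l].
have Ey : E g1 y by split=> // l _; rewrite /left /right !ffunE.
have [Sx xz xg1] : E g1 (get (E g1)) by apply: getPex; exists y.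
set x := get (E g1) in Sx xz xg1.
(* This point mixes [y] and [x]: it is within one mesh of [y], and differs from [x] in the
   coordinate [k] alone. As [f] vanishes at [x] and [y], its value at [y'] bounds the difference of
   their [k]-th coordinates. *)
pose y' : 'rV[R]_m := \row_l if l == k then y 0 k else x 0 l.
have y'z : `|y' - z| <= r.
  apply/(mx_norm_leP _ (ltW r0)) => l; rewrite !mxE.
  have /(mx_norm_leP _ (ltW r0))/(_ l) := yz.
  have /(mx_norm_leP _ (ltW r0))/(_ l) := xz.
  by rewrite !mxE; case: eqP => [->|].
have yy' : `|y - y'| <= 2 * r / N.+1%:R.
  have h0 : 0 <= 2 * r / N.+1%:R by rewrite divr_ge0// ltW.
  apply/(mx_norm_leP _ h0) => l; rewrite !mxE; case: eqP => [->|/eqP lk].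
    by rewrite subrr normr0.
  have [_ _ /(_ l lk) /andP[a1 a2]] := Ey; have /andP[b1 b2] := xg1 l lk.
  rewrite -(widthE (z 0 l - r) (2 * r) (g1 l)) -/(left g1 l) -/(right g1 l).
  rewrite ler_norml; apply/andP; split.
    by rewrite opprB lerB.
  by rewrite lerB.
have xk : `|x 0 k - y 0 k| <= eta / 2.
  have := fk x y' xz y'z; rewrite f0// -(f0 y)// => /(_ _)/le_trans/(_ (HN _ _ yz y'z yy')).
  rewrite mxE eqxx => H; rewrite -(ler_pM2l d0) (le_trans (H _))//.
    by move=> l lk; rewrite mxE (negbTE lk).
  by rewrite le_eqVlt; apply/orP; left; apply/eqP; field.
have [i Hi] : exists i : 'I_N.+1, c g1 + eta * (i%:R / N.+1%:R) <= y 0 k <=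
    c g1 + eta * (i.+1%:R / N.+1%:R).
  apply: grid_cell; first exact: ltW.
  rewrite /c -/x; move: xk; rewrite distrC ler_distl => /andP[-> xk2].
  by rewrite (le_trans xk2)// le_eqVlt; apply/orP; left; apply/eqP; field.
(* Changing the index at [k] leaves the cell, hence the chosen centre, unchanged and selects the
   piece of the slab containing [y]. *)
pose g : T := [ffun l => if l == k then i else g0 l].
have gg1 l : l != k -> g l = g1 l by move=> lk; rewrite !ffunE (negbTE lk).
have EE : E g = E g1.
  by apply/seteqP; split=> u [? ? H]; split=> // l lk; have := H l lk;
    rewrite /left /right (gg1 l lk).
have cE : c g = c g1 by rewrite /c EE.
exists g => // l; rewrite !mxE; case: eqP => [->|/eqP lk].
  by rewrite cE /g !ffunE eqxx.
by rewrite /left /right gg1// ffunE; exact: Hg0.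
Qed.

End Hypersurface.

Section NullPairing.
Context {R : realType} {n : nat} {M : topologicalType} {A : atlas R n M}.
Hypothesis hA : is_manifold A.
Local Notation TA := (cotangent_atlas A).

Lemma null_in_charts_subset (N N' : set (cotangent R n M)) :
  N `<=` N' -> null_in_charts TA N' -> null_in_charts TA N.
Proof.
move=> NN' nN i; have := nN i; apply: null_set_subset => x [lam [Nlam ilam] <-].
by exists lam => //; split => //; exact: NN'.
Qed.

Lemma null_in_chartsU (N N' : set (cotangent R n M)) : (0 < n)%N ->
  null_in_charts TA N -> null_in_charts TA N' -> null_in_charts TA (N `|` N').
Proof.
move=> n0 nN nN' i; have nn0 : (0 < n + n)%N by rewrite addn_gt0 n0.
have := null_set_union nn0 (nN i) (nN' i); apply: null_set_subset => x [lam [[Nl|Nl] il] <-].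
  by left; exists lam.
by right; exists lam.
Qed.

Lemma field_in_neq0 (X : M -> 'rV[R]_n) (i : chart_index A) q :
  dom i q -> X q != 0 -> field_in i X (chart i q) != 0.
Proof.
move=> iq; apply: contraNN => /eqP; rewrite (field_in_chart hA X iq) => E.
have aq := chart_at_dom hA q.
by rewrite -(mulmx1 (X q)) -(tangent_idK hA aq iq) mulmxA E mul0mx.
Qed.

(** In a chart the pairing is affine in each momentum coordinate, with the matching component of [X]
    as slope. Some component is nonzero at the given point and keeps at least half its absolute
    value nearby, which gives the rate [d]. *)
Lemma null_pairing (X : M -> 'rV[R]_n) : (0 < n)%N ->
  smooth_entries A X -> (forall q, X q != 0) -> null_in_charts TA [set lam | pairing X lam = 0].
Proof.
have half_le (a b c : R) : a - b <= c -> c < a / 2 -> a / 2 <= b by lra.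
move=> n0 sX X0 i; apply: null_set_local => [|z0 [lam [/= lam0 ilam] z0E]].
  by rewrite addn_gt0 n0.
have iq : dom (a := A) i lam.1 := ilam.
have x0E : lsubmx z0 = chart (a := A) i lam.1 by rewrite -z0E /= row_mxKl.
have [k Vk0] : exists k, field_in (A := A) i X (lsubmx z0) 0 k != 0.
  have := field_in_neq0 iq (X0 lam.1); rewrite -x0E => /negP V0.
  apply: contrapT => H; apply: V0; apply/eqP/rowP => k; rewrite [RHS]mxE.
  by apply: contrapT => /eqP Vk; apply: H; exists k.
pose V (z : 'rV[R]_(n + n)) := field_in (A := A) i X (lsubmx z) 0 k.
have Vc : {for z0, continuous V}.
  apply: (@continuous_comp _ _ _ (lsubmx : 'rV[R]_(n + n) -> 'rV[R]_n)
    (fun x => field_in (A := A) i X x 0 k)); first exact: continuous_lsubmx.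
  apply: differentiable_continuous; apply: (smooth_on_differentiable (sX i k)).
  by rewrite x0E; exact: chart_rangeP.
pose d := `|V z0| / 2; have d0 : 0 < d by rewrite divr_gt0// normr_gt0.
have near_z0 : \forall z \near z0, chart_range (A := A) i (lsubmx z) /\ d <= `|V z|.
  have h1 : \forall z \near z0, chart_range (A := A) i (lsubmx z).
    apply: continuous_lsubmx; apply: (near_range hA).
    by rewrite x0E; exact: chart_rangeP.
  have h2 : \forall z \near z0, `|V z0 - V z| < d.
    by move: Vc => /cvgrPdist_lt; exact.
  apply: filterS (filterI h1 h2) => z [iz Vz]; split=> //.
  exact: half_le (lerB_dist (V z0) (V z)) Vz.
have /nbhs_ballP[r /= r0 Hr] := near_z0.
have r20 : 0 < r / 2 by rewrite divr_gt0.
have Hr' y : `|y - z0| <= r / 2 -> chart_range (A := A) i (lsubmx y) /\ d <= `|V y|.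
  move=> yz; apply: Hr; rewrite -ball_normE/= distrC (le_lt_trans yz)//.
  by rewrite ltr_pdivrMr// ltr_pMr// ltr1n.
pose F z := (rsubmx z *m (field_in (A := A) i X (lsubmx z))^T) 0 0.
have FE : pairing X \o param (a := TA) i = F.
  by apply/funext => z; exact: pairing_param.
exists (r / 2) => //.
apply: (@null_set_hypersurface _ _ _ F z0 (r / 2) d
  (rshift n k)) => //.
- move=> y /Hr'[iy _]; apply: differentiable_continuous.
  have iy' : chart_range (A := TA) i y by rewrite (cotangent_rangeE hA).
  have sP : smooth_fun TA (pairing X) := smooth_fun_pairing hA sX.
  by have := smooth_on_differentiable (sP i) iy'; rewrite FE.
- move=> y [mu [mu0 imu] <-] _; have := cotangent_chartK hA imu.
  by rewrite -FE /comp => ->.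
- move=> y y' /Hr'[_ dV] _ E; rewrite /F.
  have -> : lsubmx y' = lsubmx y.
    by apply/rowP => l; rewrite !mxE E// eq_lrshift.
  set v := field_in _ _ _ in dV *.
  have -> : (rsubmx y *m v^T) 0 0 - (rsubmx y' *m v^T) 0 0 =
      (y 0 (rshift n k) - y' 0 (rshift n k)) * v 0 k.
    rewrite !mxE -sumrB (bigD1 k)//= big1 ?addr0; last first.
      move=> l lk; rewrite !mxE E ?subrr//.
      by apply: contraNneq lk => /rshift_inj ->.
    by rewrite !mxE mulrBl.
  by rewrite normrM mulrC ler_wpM2l.
Qed.

End NullPairing.

(** * First integrals *)

Section Frame.
Context {R : realType} {n : nat} (G : lieGroup R n).
Local Notation A := (lie_atlas G).
Let hA : is_manifold A := lie_manifold (lie_groupP G).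

(** A relation at the single point [q] is carried to every point by left translation, where
    independence of the fields applies. *)
Lemma lie_basis_free d (X : d.-tuple (G -> 'rV[R]_n)) (c : 'I_d -> R) q :
  lie_basis X -> \sum_j c j *: tnth X j q = 0 -> forall j, c j = 0.
Proof.
move=> [LX indep _] c0; apply: indep => p.
have -> : p = lie_mul (lie_mul p (lie_inv q)) q.
  by rewrite -lie_mulgA lie_mulVg lie_mulg1.
move: (lie_mul p (lie_inv q)) => g.
have -> : \sum_j c j *: tnth X j (lie_mul g q) =
    (\sum_j c j *: tnth X j q) *m
    tangent (chart_at A q) (chart_at A (lie_mul g q)) (lie_mul g) q.
  rewrite mulmx_suml; apply: eq_bigr => j _; rewrite -scalemxAl.
  by have [_ ->] := LX j; rewrite tangent.unlock.
by rewrite c0 mul0mx.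
Qed.

End Frame.

(** [dC1] and [dC2] are the differentials of [casimir1] and [casimir2] below. Only the bracket table
    enters, so bilinearity and antisymmetry leave polynomial identities. *)
Lemma casimir_omega (R : realType) (n : nat) (T3 T4 T6 h1 h2 h3 h4 : R)
    (d1 d2 d3 d4 : 'rV[R]_(n + n)) :
  omega d1 d2 = h3 -> omega d1 d3 = h4 -> omega d1 d4 = T3 * h3 ->
  omega d2 d3 = T6 * h1 + T4 * h2 -> omega d2 d4 = T4 * h3 ->
  omega d3 d4 = - (T6 * T3) * h1 - T4 * T3 * h2 + T4 * h4 ->
  let dH := h1 *: d1 + h2 *: d2 in
  let dC1 := d4 + (T4 *: d1 + (- T3) *: d2) in
  let dC2 := (T6 * h1) *: d1 + (T3 * h2 - h4) *: d2 + h3 *: d3 + (- h2) *: d4 in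
  [/\ omega dH dC1 = 0, omega dH dC2 = 0 & omega dC1 dC2 = 0].
Proof.
move=> w12 w13 w14 w23 w24 w34 dH dC1 dC2.
have w21 := omegaC d2 d1; have w41 := omegaC d4 d1; have w42 := omegaC d4 d2.
have w43 := omegaC d4 d3; rewrite w12 w14 w24 w34 in w21 w41 w42 w43.
by split; rewrite /dH /dC1 /dC2 !omega_bilinear !omega_self
  ?w12 ?w13 ?w14 ?w23 ?w24 ?w21 ?w41 ?w42 ?w43; ring.
Qed.

Lemma independent_combination (R : realType) (n : nat) (T3 T4 T6 h1 h2 h3 h4 : R)
    (d1 d2 d3 d4 e1 e3 : 'rV[R]_(n + n)) (a b c e f : R) :
  let dH := h1 *: d1 + h2 *: d2 in
  let dC1 := d4 + (T4 *: d1 + (- T3) *: d2) in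
  let dC2 := (T6 * h1) *: d1 + (T3 * h2 - h4) *: d2 + h3 *: d3 + (- h2) *: d4 in
  (forall a1 a2 a3 a4 : R, a1 *: rsubmx d1 + a2 *: rsubmx d2 + a3 *: rsubmx d3
     + a4 *: rsubmx d4 = 0 -> [/\ a1 = 0, a2 = 0, a3 = 0 & a4 = 0]) ->
  [/\ omega dH e1 = 0, omega dC1 e1 = 0 & omega dC2 e1 = 0] ->
  [/\ omega dH e3 = 0, omega dC1 e3 = 0 & omega dC2 e3 = 0] ->
  h1 != 0 -> h3 != 0 -> omega e1 e3 != 0 ->
  a *: dH + (b *: dC1 + (c *: dC2 + (e *: e1 + f *: e3))) = 0 ->
  [/\ a = 0, b = 0, c = 0, e = 0 & f = 0].
Proof.
move=> dH dC1 dC2 free [w1 w2 w3] [w4 w5 w6] h10 h30 w13 E.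
have omega0 (u : 'rV[R]_(n + n)) : omega 0 u = 0.
  by have := omegaZl 0 0 u; rewrite scale0r mul0r.
have f0 : f = 0.
  have := congr1 (fun u => omega u e1) E.
  rewrite /= !omegaDl !omegaZl w1 w2 w3 omega_self omegaC omega0 !mulr0 !add0r.
  by move=> /eqP; rewrite mulf_eq0 oppr_eq0 (negbTE w13) orbF => /eqP.
have e0 : e = 0.
  have := congr1 (fun u => omega u e3) E.
  rewrite /= !omegaDl !omegaZl w4 w5 w6 omega_self omega0 !mulr0 !add0r addr0.
  by move=> /eqP; rewrite mulf_eq0 (negbTE w13) orbF => /eqP.
(* These are the coefficients of [d1] to [d4]. The system is triangular: [d3] gives [c], then [d4]
   gives [b], then [d1] gives [a]. *)
have [] := free (a * h1 + b * T4 + c * (T6 * h1)) (a * h2 - b * T3 + c * (T3 * h2 - h4))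
  (c * h3) (b - c * h2).
  apply/rowP => l; have := congr1 (fun u : 'rV[R]_(n + n) => u 0 (rshift n l)) E.
  by rewrite e0 f0 !mxE => <-; ring.
move=> aE _ cE bE.
have c0 : c = 0 by move: cE => /eqP; rewrite mulf_eq0 (negbTE h30) orbF => /eqP.
have b0 : b = 0 by move: bE; rewrite c0 mul0r subr0.
have a0 : a = 0.
  by move: aE => /eqP; rewrite b0 c0 !mul0r !addr0 mulf_eq0 (negbTE h10) orbF => /eqP.
by [].
Qed.

(** * Casimirs and super-integrability of the Engel structure *)

Section Engel.
Context {R : realType} {T3 T4 T6 : R} {G : lieGroup R 4} {X1 X2 X3 X4 : G -> 'rV[R]_4}.
Local Notation A := (lie_atlas G).
Local Notation TA := (cotangent_atlas (lie_atlas G)).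
Hypothesis basisX : lie_basis [tuple X1; X2; X3; X4].
Hypothesis X12 : field_bracket A X1 X2 = X3.
Hypothesis X13 : field_bracket A X1 X3 = X4.
Hypothesis X14 : field_bracket A X1 X4 = T3 *: X3.
Hypothesis X23 : field_bracket A X2 X3 = T6 *: X1 + T4 *: X2.
Hypothesis X24 : field_bracket A X2 X4 = T4 *: X3.
Hypothesis X34 : field_bracket A X3 X4 =
  - (T6 * T3) *: X1 - (T4 * T3) *: X2 + T4 *: X4.

Let hA : is_manifold A := lie_manifold (lie_groupP G).
Implicit Types (lam : cotangent R 4 G) (q : G).

Lemma frame_left_invariant : [/\ left_invariant X1, left_invariant X2,
  left_invariant X3 & left_invariant X4].
Proof.
have [LX _ _] := basisX.
by split; [exact: (LX (@Ordinal 4 0 isT))|exact: (LX (@Ordinal 4 1 isT))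
  |exact: (LX (@Ordinal 4 2 isT))|exact: (LX (@Ordinal 4 3 isT))].
Qed.

Let LX1 : left_invariant X1. Proof. by have [] := frame_left_invariant. Qed.
Let LX2 : left_invariant X2. Proof. by have [] := frame_left_invariant. Qed.
Let LX3 : left_invariant X3. Proof. by have [] := frame_left_invariant. Qed.
Let LX4 : left_invariant X4. Proof. by have [] := frame_left_invariant. Qed.
Let sX1 := left_invariant_smooth LX1.
Let sX2 := left_invariant_smooth LX2.
Let sX3 := left_invariant_smooth LX3.
Let sX4 := left_invariant_smooth LX4.

Lemma frame_free q (a1 a2 a3 a4 : R) :
  a1 *: X1 q + a2 *: X2 q + a3 *: X3 q + a4 *: X4 q = 0 ->
  [/\ a1 = 0, a2 = 0, a3 = 0 & a4 = 0].
Proof.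
move=> H; pose c (j : 'I_4) := nth 0 [:: a1; a2; a3; a4] j.
have : \sum_j c j *: tnth [tuple X1; X2; X3; X4] j q = 0.
  by rewrite !big_ord_recl big_ord0 addr0 !addrA.
move=> /(lie_basis_free basisX) H'.
by split; [exact: (H' (@Ordinal 4 0 isT))|exact: (H' (@Ordinal 4 1 isT))
  |exact: (H' (@Ordinal 4 2 isT))|exact: (H' (@Ordinal 4 3 isT))].
Qed.

Lemma frame_neq0 q : [/\ X1 q != 0, X3 q != 0 & X4 q != 0].
Proof.
split; apply/eqP => E.
- have [] := @frame_free q 1 0 0 0; last by move=> /eqP; rewrite oner_eq0.
  by rewrite E scaler0 !scale0r !addr0.
- have [] := @frame_free q 0 0 1 0; last by move=> _ _ /eqP; rewrite oner_eq0.
  by rewrite E scaler0 !scale0r !addr0.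
- have [] := @frame_free q 0 0 0 1; last by move=> _ _ _ /eqP; rewrite oner_eq0.
  by rewrite E scaler0 !scale0r !addr0.
Qed.

Lemma covector_eq0 lam : pairing X1 lam = 0 -> pairing X2 lam = 0 ->
  pairing X3 lam = 0 -> pairing X4 lam = 0 -> lam.2 = 0.
Proof.
case: lam => q p; rewrite /pairing/= => p1 p2 p3 p4.
pose B : 'M[R]_4 := \matrix_(j < 4) tnth [tuple X1; X2; X3; X4] j q.
have Bfree : row_free B.
  apply: inj_row_free => v; rewrite mulmx_sum_row.
  under eq_bigr do rewrite rowK.
  by move=> /(lie_basis_free basisX) v0; apply/rowP => j; rewrite v0 mxE.
have BU : B \in unitmx by rewrite -row_free_unit.
apply/trmx_inj; rewrite trmx0 -(mulKmx BU p^T).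
suff -> : B *m p^T = 0 by rewrite mulmx0.
apply/colP => j; rewrite [RHS]mxE.
have -> : (B *m p^T) j 0 = (p *m (row j B)^T) 0 0.
  by rewrite -[p in RHS]trmxK -trmx_mul [RHS]mxE -row_mul [RHS]mxE.
rewrite rowK.
by case: j => [[|[|[|[|//]]]] ?].
Qed.

Lemma pairingD (X Y : G -> 'rV[R]_4) lam :
  pairing (X + Y) lam = pairing X lam + pairing Y lam.
Proof. by rewrite /pairing linearD/= mulmxDr mxE. Qed.

Lemma pairingZ c (X : G -> 'rV[R]_4) lam : pairing (c *: X) lam = c * pairing X lam.
Proof. by rewrite /pairing linearZ/= -scalemxAr mxE. Qed.

Lemma pairingN (X : G -> 'rV[R]_4) lam : pairing (- X) lam = - pairing X lam.
Proof. by rewrite /pairing linearN/= mulmxN mxE. Qed.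

Local Notation h1 := (pairing X1).
Local Notation h2 := (pairing X2).
Local Notation h3 := (pairing X3).
Local Notation h4 := (pairing X4).
Local Notation dh X lam := (differential TA (pairing X) lam).

Lemma omega_frame lam :
  [/\ omega (dh X1 lam) (dh X2 lam) = h3 lam,
      omega (dh X1 lam) (dh X3 lam) = h4 lam,
      omega (dh X1 lam) (dh X4 lam) = T3 * h3 lam,
      omega (dh X2 lam) (dh X3 lam) = T6 * h1 lam + T4 * h2 lam &
      omega (dh X2 lam) (dh X4 lam) = T4 * h3 lam /\
      omega (dh X3 lam) (dh X4 lam) =
        - (T6 * T3) * h1 lam - T4 * T3 * h2 lam + T4 * h4 lam].
Proof.
rewrite !(omega_pairing hA)// X12 X13 X14 X23 X24 X34 !pairingD !pairingZ.
by rewrite pairingN pairingZ.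
Qed.

Lemma omega_inv_field X Y lam : left_invariant X -> left_invariant Y ->
  omega (dh (inv_field Y) lam) (dh X lam) = 0.
Proof.
move=> LX LY; rewrite (omega_pairing hA) ?/pairing.
- by rewrite bracket_left_invariant_inv_field// trmx0 mulmx0 mxE.
- exact: inv_field_smooth.
- exact: left_invariant_smooth.
Qed.

Lemma omega_inv_fields lam :
  omega (dh (inv_field X1) lam) (dh (inv_field X3) lam) = pairing (inv_field X4) lam.
Proof.
rewrite (omega_pairing hA); [|exact: inv_field_smooth..].
by rewrite bracket_inv_field// X13.
Qed.

(* The central element X4 + T4 X1 - T3 X2. *)
Definition casimir1 lam : R := h4 lam + (T4 * h1 lam + (- T3) * h2 lam).

(* On a level set of casimir1, the brackets {h2, h3}, {h3, h1}, {h1, h2} are the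
   partial derivatives of h3^2/2 + T6 h1^2/2 + T4 h1 h2 - T3 h2^2/2
   - casimir1 h2, which is casimir2. *)
Definition casimir2 lam : R :=
  2^-1 * (h3 lam * h3 lam + (T6 * (h1 lam * h1 lam) + T3 * (h2 lam * h2 lam)))
  + (-1) * (h2 lam * h4 lam).

Let oTA := @cotangent_range_open _ _ _ _ hA.
Let sh1 : smooth_fun TA h1 := smooth_fun_pairing hA sX1.
Let sh2 : smooth_fun TA h2 := smooth_fun_pairing hA sX2.
Let sh3 : smooth_fun TA h3 := smooth_fun_pairing hA sX3.
Let sh4 : smooth_fun TA h4 := smooth_fun_pairing hA sX4.

Lemma normal_hamiltonianE : normal_hamiltonian X1 X2 =
  fun lam => 2^-1 * (h1 lam * h1 lam + h2 lam * h2 lam).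
Proof. by apply/funext => lam; rewrite /normal_hamiltonian !expr2 mulrC. Qed.

Let sM F F' (sF : smooth_fun TA F) (sF' : smooth_fun TA F') := smooth_funM oTA sF sF'.
Let sD F F' (sF : smooth_fun TA F) (sF' : smooth_fun TA F') := smooth_funD oTA sF sF'.
Let sZ c F (sF : smooth_fun TA F) := smooth_funZ oTA c sF.

Lemma smooth_normal_hamiltonian : smooth_fun TA (normal_hamiltonian X1 X2).
Proof.
rewrite normal_hamiltonianE.
exact: (sZ 2^-1 (sD (sM sh1 sh1) (sM sh2 sh2))).
Qed.

Lemma smooth_casimir1 : smooth_fun TA casimir1.
Proof. exact: (sD sh4 (sD (sZ T4 sh1) (sZ (- T3) sh2))). Qed.

Lemma smooth_casimir2 : smooth_fun TA casimir2.
Proof.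
exact: (sD (sZ 2^-1 (sD (sM sh3 sh3) (sD (sZ T6 (sM sh1 sh1)) (sZ T3 (sM sh2 sh2)))))
  (sZ (-1) (sM sh2 sh4))).
Qed.

Let dD lam F F' (sF : smooth_fun TA F) (sF' : smooth_fun TA F') :=
  differentialD (diff_fun_smooth hA lam sF) (diff_fun_smooth hA lam sF').
Let dZ lam c F (sF : smooth_fun TA F) := differentialZ c (diff_fun_smooth hA lam sF).
Let dM lam F F' (sF : smooth_fun TA F) (sF' : smooth_fun TA F') :=
  differentialM (cotangent_chartK hA (cotangent_at_dom hA lam))
    (diff_fun_smooth hA lam sF) (diff_fun_smooth hA lam sF').

Lemma differential_normal_hamiltonian lam :
  differential TA (normal_hamiltonian X1 X2) lam = h1 lam *: dh X1 lam + h2 lam *: dh X2 lam.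
Proof.
rewrite normal_hamiltonianE (dZ lam 2^-1 (sD (sM sh1 sh1) (sM sh2 sh2))).
rewrite (dD lam (sM sh1 sh1) (sM sh2 sh2)) (dM lam sh1 sh1) (dM lam sh2 sh2).
(* Differentials are themselves defined as rows; generalizing them keeps [mxE] from unfolding their
   entries. *)
move: (dh X1 lam) (dh X2 lam) => d1 d2.
by apply/rowP => l; rewrite !mxE; field.
Qed.

Lemma differential_casimir1 lam : differential TA casimir1 lam =
  dh X4 lam + (T4 *: dh X1 lam + (- T3) *: dh X2 lam).
Proof.
rewrite (dD lam sh4 (sD (sZ T4 sh1) (sZ (- T3) sh2))).
by rewrite (dD lam (sZ T4 sh1) (sZ (- T3) sh2)) (dZ lam T4 sh1) (dZ lam (- T3) sh2).
Qed.

Lemma differential_casimir2 lam : differential TA casimir2 lam =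
  (T6 * h1 lam) *: dh X1 lam + (T3 * h2 lam - h4 lam) *: dh X2 lam
  + h3 lam *: dh X3 lam + (- h2 lam) *: dh X4 lam.
Proof.
have sQ1 := sM sh1 sh1; have sQ2 := sM sh2 sh2; have sQ3 := sM sh3 sh3.
have sQ := sD (sZ T6 sQ1) (sZ T3 sQ2).
rewrite (dD lam (sZ 2^-1 (sD sQ3 sQ)) (sZ (-1) (sM sh2 sh4))).
rewrite (dZ lam 2^-1 (sD sQ3 sQ)) (dZ lam (-1) (sM sh2 sh4)) (dM lam sh2 sh4).
rewrite (dD lam sQ3 sQ) (dM lam sh3 sh3) (dD lam (sZ T6 sQ1) (sZ T3 sQ2)).
rewrite (dZ lam T6 sQ1) (dZ lam T3 sQ2) (dM lam sh1 sh1) (dM lam sh2 sh2).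
move: (dh X1 lam) (dh X2 lam) (dh X3 lam) (dh X4 lam) => d1 d2 d3 d4.
by apply/rowP => l; rewrite !mxE; field.
Qed.

Local Notation Y1 := (inv_field X1).
Local Notation Y3 := (inv_field X3).
Let sY1 : smooth_fun TA (pairing Y1) := smooth_fun_pairing hA (inv_field_smooth LX1).
Let sY3 : smooth_fun TA (pairing Y3) := smooth_fun_pairing hA (inv_field_smooth LX3).

Lemma omega_integrals lam :
  let dH := differential TA (normal_hamiltonian X1 X2) lam in
  let dC1 := differential TA casimir1 lam in
  let dC2 := differential TA casimir2 lam in
  [/\ omega dH dC1 = 0, omega dH dC2 = 0, omega dC1 dC2 = 0
    & forall Y, left_invariant Y -> let dY := dh (inv_field Y) lam in
      [/\ omega dH dY = 0, omega dC1 dY = 0 & omega dC2 dY = 0]].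
Proof.
have [w12 w13 w14 w23 [w24 w34]] := omega_frame lam.
have [H1 H2 H3] := casimir_omega w12 w13 w14 w23 w24 w34.
rewrite differential_normal_hamiltonian differential_casimir1 differential_casimir2.
split=> // Y LY.
have e X : left_invariant X -> omega (dh X lam) (dh (inv_field Y) lam) = 0.
  by move=> LX; rewrite omegaC omega_inv_field// oppr0.
have := e _ LX4; have := e _ LX3; have := e _ LX2; have := e _ LX1.
move: (dh X1 lam) (dh X2 lam) (dh X3 lam) (dh X4 lam) (dh (inv_field Y) lam).
move=> d1 d2 d3 d4 dY e1 e2 e3 e4.
by split; rewrite !omega_bilinear ?e1 ?e2 ?e3 ?e4; ring.
Qed.

Lemma integrals_independent lam (a b c e f : R) :
  h1 lam != 0 -> h3 lam != 0 -> pairing (inv_field X4) lam != 0 ->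
  a *: differential TA (normal_hamiltonian X1 X2) lam
  + (b *: differential TA casimir1 lam + (c *: differential TA casimir2 lam
  + (e *: dh Y1 lam + f *: dh Y3 lam))) = 0 ->
  [/\ a = 0, b = 0, c = 0, e = 0 & f = 0].
Proof.
move=> h10 h30 hY0.
have [_ _ _ wY] := omega_integrals lam.
have := wY _ LX3; have := wY _ LX1.
rewrite differential_normal_hamiltonian differential_casimir1 differential_casimir2.
move=> w1 w3; apply: (fun free => independent_combination free w1 w3 h10 h30).
  move=> a1 a2 a3 a4.
  rewrite (differential_pairing_rsub hA lam sX1) (differential_pairing_rsub hA lam sX2).
  rewrite (differential_pairing_rsub hA lam sX3) (differential_pairing_rsub hA lam sX4).
  exact: frame_free.
by rewrite omega_inv_fields.
Qed.

(** This set contains every covector at which the differentials of the integrals can be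
    dependent. *)
Lemma null_bad : null_in_charts TA
  [set lam | h1 lam = 0 \/ h3 lam = 0 \/ pairing (inv_field X4) lam = 0].
Proof.
have := null_in_chartsU (A := A) (isT : (0 < 4)%N)
  (null_pairing hA isT sX1 (fun q => let: And3 h _ _ := frame_neq0 q in h))
  (null_in_chartsU (A := A) (isT : (0 < 4)%N)
    (null_pairing hA isT sX3 (fun q => let: And3 _ h _ := frame_neq0 q in h))
    (null_pairing hA isT (inv_field_smooth LX4)
       (fun q => inv_field_neq0 (let: And3 _ _ h := frame_neq0 (lie_inv q) in h)))).
by apply: null_in_charts_subset => lam [|[]]; [left|right; left|right; right].
Qed.

Lemma forall_tnth4 (T : Type) (P : T -> Prop) (a b c d : T) :
  P a -> P b -> P c -> P d -> forall j, P (tnth [tuple a; b; c; d] j).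
Proof. by move=> pa pb pc pd [[|[|[|[|//]]]] ?]. Qed.

Lemma super_integrable_normal_hamiltonian :
  super_integrable A (normal_hamiltonian X1 X2).
Proof.
have sH := smooth_normal_hamiltonian.
have sC1 := smooth_casimir1; have sC2 := smooth_casimir2.
have wH1 : poisson_commute A (normal_hamiltonian X1 X2) casimir1.
  by move=> lam; have [w _ _ _] := omega_integrals lam; rewrite poissonE w.
have wH2 : poisson_commute A (normal_hamiltonian X1 X2) casimir2.
  by move=> lam; have [_ w _ _] := omega_integrals lam; rewrite poissonE w.
have w12 : poisson_commute A casimir1 casimir2.
  by move=> lam; have [_ _ w _] := omega_integrals lam; rewrite poissonE w.
have wHY Y : left_invariant Y ->
    poisson_commute A (normal_hamiltonian X1 X2) (pairing (inv_field Y)).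
  move=> LY lam; have [_ _ _ w] := omega_integrals lam.
  by have [wY _ _] := w _ LY; rewrite poissonE wY.
have w1Y : poisson_commute A casimir1 (pairing Y1).
  move=> lam; have [_ _ _ w] := omega_integrals lam.
  by have [_ wY _] := w _ LX1; rewrite poissonE wY.
have w2Y : poisson_commute A casimir2 (pairing Y1).
  move=> lam; have [_ _ _ w] := omega_integrals lam.
  by have [_ _ wY] := w _ LX1; rewrite poissonE wY.
have wxx F : poisson_commute A F F by move=> lam; rewrite poissonE omega_self.
have wC F F' : poisson_commute A F F' -> poisson_commute A F' F.
  by move=> FF' lam; rewrite poissonE omegaC -poissonE FF' oppr0.
have wHY1 := wHY _ LX1; have wHY3 := wHY _ LX3.
exists casimir1, casimir2, (pairing Y1), (pairing Y3); split.
- apply: forall_tnth4.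
  + exact: (first_integralP hA sH (wxx _)).
  + exact: (first_integralP hA sC1 wH1).
  + exact: (first_integralP hA sC2 wH2).
  + exact: (first_integralP hA sY1 wHY1).
- pose P F F' := poisson_commute A F F'.
  apply: (@forall_tnth4 _ (fun F => forall k, P F (tnth _ k)));
    apply: (@forall_tnth4 _ (P _)).
  + exact: wxx.
  + exact: wH1.
  + exact: wH2.
  + exact: wHY1.
  + exact: (wC _ _ wH1).
  + exact: wxx.
  + exact: w12.
  + exact: w1Y.
  + exact: (wC _ _ wH2).
  + exact: (wC _ _ w12).
  + exact: wxx.
  + exact: w2Y.
  + exact: (wC _ _ wHY1).
  + exact: (wC _ _ w1Y).
  + exact: (wC _ _ w2Y).
  + exact: wxx.
- apply: null_in_charts_subset null_bad => lam /=.
  apply: contraNP => /not_orP[/eqP h10 /not_orP[/eqP h30 /eqP hY0]].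
  apply: inj_row_free => v; rewrite mulmx_sum_row.
  under eq_bigr do rewrite rowK.
  rewrite !big_ord_recl big_ord0 addr0 => E.
  (* The four-function case is the five-function one with coefficient 0 on the differential of
     [pairing Y3]. *)
  rewrite -[X in _ + (_ + (_ + X)) = _]addr0
    -[X in _ + (_ + (_ + (_ + X))) = _](scale0r (dh Y3 lam)) in E.
  have [a0 b0 c0 e0 _] := integrals_independent h10 h30 hY0 E.
  by apply/rowP; case=> [[|[|[|[|//]]]] ?]; rewrite mxE;
    [rewrite -a0|rewrite -b0|rewrite -c0|rewrite -e0]; congr (v 0 _); exact: val_inj.
split; [exact: (first_integralP hA sY3 wHY3)|exact: (wC _ _ wHY3)|].
apply: null_in_charts_subset null_bad => lam /=.
apply: contraNP => /not_orP[/eqP h10 /not_orP[/eqP h30 /eqP hY0]].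
apply: inj_row_free => v; rewrite mulmx_sum_row.
under eq_bigr do rewrite rowK.
rewrite !big_ord_recl big_ord0 addr0 => E.
have [a0 b0 c0 e0 f0] := integrals_independent h10 h30 hY0 E.
by apply/rowP; case=> [[|[|[|[|[|//]]]]] ?]; rewrite mxE;
  [rewrite -a0|rewrite -b0|rewrite -c0|rewrite -e0|rewrite -f0];
  congr (v 0 _); exact: val_inj.
Qed.

End Engel.

(** * Extremals *)

Section AlmostEverywhere.
Context {R : realType}.
Local Notation mu := (@lebesgue_measure R).
Implicit Types (a b s t : R) (P : R -> Prop).

#[local] Instance ae_lebesgue_filter : Filter (almost_everywhere mu) :=
  ae_filter_ringOfSetsType mu.

(** The interval is open because the identities are differentiated at interior points. *)
Definition ae_on a b P := {ae mu, forall t, t \in `]a, b[ -> P t}.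

Lemma ae_on_cc a b P : {ae mu, forall t, t \in `[a, b] -> P t} -> ae_on a b P.
Proof. by apply: filterS => t H tab; apply/H/subset_itv_oo_cc. Qed.

Lemma ae_onI a b P Q : ae_on a b P -> ae_on a b Q -> ae_on a b (fun t => P t /\ Q t).
Proof.
rewrite /ae_on => aP aQ; apply: filterS (filterI aP aQ) => t [Pt Qt] tab.
by split; [exact: Pt|exact: Qt].
Qed.

Lemma ae_onS a b P Q : (forall t, t \in `]a, b[ -> P t -> Q t) ->
  ae_on a b P -> ae_on a b Q.
Proof. by move=> PQ; rewrite /ae_on; apply: filterS => t Pt tab; exact/PQ/Pt. Qed.

(** Otherwise the whole interval would be negligible, although its measure is positive. *)
Lemma ae_on_witness a b P : a < b -> ae_on a b P -> exists2 t, t \in `]a, b[ & P t.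
Proof.
move=> ab aP; apply: contrapT => noP.
have : mu.-negligible `]a, b[%classic.
  apply: negligibleS aP => t /= tab Pt; apply: noP; exists t => //; exact: Pt.
move=> /negligibleP -/(_ (measurable_itv _)) /=.
rewrite lebesgue_measure_itv/= lte_fin ab -EFinD => /eqP.
by rewrite eqe subr_eq0 gt_eqF.
Qed.

(** A nonzero value would persist on a short interval to the right of [t], which must contain a zero
    by [ae_on_witness]. *)
Lemma ae_on_continuous_eq0 a b (f : R -> R) :
  (forall t, t \in `]a, b[ -> {for t, continuous f}) ->
  ae_on a b (fun t => f t = 0) -> forall t, t \in `]a, b[ -> f t = 0.
Proof.
move=> cf af t tab; apply: contrapT => /eqP ft0.
have ft : 0 < `|f t| by rewrite normr_gt0.
have near_t : \forall s \near t, f s != 0 /\ s \in `]a, b[.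
  have h1 : \forall s \near t, `|f t - f s| < `|f t|.
    by move: (cf t tab) => /cvgrPdist_lt; exact.
  have h2 : \forall s \near t, s \in `]a, b[ by exact: near_in_itvoo.
  apply: filterS (filterI h1 h2) => s [fs sab]; split=> //.
  by apply: contraTneq fs => ->; rewrite subr0 ltxx.
have /nbhs_ballP[e /= e0 He] := near_t.
have te s : s \in `]t, (t + e)[ -> f s != 0 /\ s \in `]a, b[.
  rewrite in_itv/= => /andP[ts se]; apply: He.
  by rewrite -ball_normE/= distrC ger0_norm ?subr_ge0 ?(ltW ts)// ltrBlDl.
have [s st fs] : exists2 s, s \in `]t, (t + e)[ & f s = 0.
  apply: ae_on_witness; first by rewrite ltrDl.
  by move: af; rewrite /ae_on; apply: filterS => s fs /te[_ sab]; exact: fs.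
by have [/eqP] := te s st.
Qed.

Lemma derive_eq0_on a b (f : R -> R) t v : (forall s, s \in `]a, b[ -> f s = 0) ->
  t \in `]a, b[ -> is_derive (t : R^o) 1 (f : R^o -> R^o) v -> v = 0.
Proof.
move=> f0 tab fv; rewrite -(@derive_val _ _ _ _ _ _ _ fv).
rewrite (@near_eq_derive _ _ _ f (cst 0)); first exact: derive_cst.
have : \forall s \near t, s \in `]a, b[ by exact: near_in_itvoo.
by apply: filterS => s /f0.
Qed.

End AlmostEverywhere.

Lemma sum_sqr_le0 (R : realType) (x y : R) : x ^+ 2 + y ^+ 2 <= 0 -> x = 0 /\ y = 0.
Proof.
move=> xy; have xy0 : x ^+ 2 + y ^+ 2 == 0.
  by rewrite eq_le xy addr_ge0// sqr_ge0.
move: xy0; rewrite paddr_eq0 ?sqr_ge0// !sqrf_eq0 => /andP[/eqP-> /eqP->].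
by [].
Qed.

Section Extremals.
Context {R : realType} {n : nat} {M : topologicalType} {A : atlas R n M}.
Hypothesis hA : is_manifold A.
Local Notation TA := (cotangent_atlas A).

Lemma lipschitz_curve_continuous (F : cotangent R n M -> R) a b gam t :
  smooth_fun TA F -> lipschitz_curve TA a b gam -> t \in `]a, b[ ->
  {for t, continuous (F \o gam)}.
Proof.
move=> sF lip tab; have tcc := subset_itv_oo_cc tab.
have [e [L [e0 He]]] := lip t tcc; set i := chart_at TA (gam t) in He.
have near_t : \forall s \near t, s \in `[a, b] /\ `|s - t| < e.
  have h1 : \forall s \near t, s \in `]a, b[ by exact: near_in_itvoo.
  have h2 : \forall s \near t, `|s - t| < e.
    by apply/nbhs_ballP; exists e => //= s; rewrite -ball_normE/= distrC.
  by apply: filterS (filterI h1 h2) => s [sab ?]; split=> //; exact: subset_itv_oo_cc.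
have tt : `|t - t| < e by rewrite subrr normr0.
have cg : {for t, continuous (chart i \o gam)}.
  (* The given [L] may be zero or negative; this replacement can be divided by. *)
  have L0 : 0 < `|L| + 1 by rewrite ltr_wpDl.
  apply/cvgrPdist_lt => d d0.
  have h3 : \forall s \near t, `|s - t| < d / (`|L| + 1).
    apply/nbhs_ballP; exists (d / (`|L| + 1)) => /=; first exact: divr_gt0.
    by move=> s; rewrite -ball_normE/= distrC.
  apply: filterS (filterI near_t h3) => s [[sab se] sd].
  have [_ H] := He t s tcc sab tt se.
  rewrite (le_lt_trans H)// distrC.
  rewrite (@le_lt_trans _ _ ((`|L| + 1) * `|s - t|))//.
    by rewrite ler_wpM2r// (le_trans (ler_norm L))// lerDl.
  by rewrite mulrC -ltr_pdivlMr.
have cF : {for (chart i (gam t)), continuous (F \o param i)}.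
  exact/differentiable_continuous/(diff_fun_smooth hA (gam t) sF).
have cc : {for t, continuous ((F \o param i) \o (chart i \o gam))}.
  exact: continuous_comp.
have E : \forall s \near t, ((F \o param i) \o (chart i \o gam)) s = (F \o gam) s.
  apply: filterS near_t => s [sab se].
  have [_ H] := He t s tcc sab tt se; have [ds _] := He s t sab tcc se tt.
  by have := cotangent_chartK hA ds; rewrite /comp => ->.
have := cc; rewrite /prop_for /continuous_at (nbhs_singleton E).
by apply: cvg_trans; exact: near_eq_cvg.
Qed.

(** The term in [nu] is constant on the cotangent bundle, so normal and abnormal extremals with the
    same control obey the same equations. *)
Lemma differential_control_hamiltonian (X1 X2 : M -> 'rV[R]_n) w nu lam :
  smooth_entries A X1 -> smooth_entries A X2 ->
  differential TA (control_hamiltonian X1 X2 w nu) lam =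
  w.1 *: differential TA (pairing X1) lam + w.2 *: differential TA (pairing X2) lam.
Proof.
move=> /(smooth_fun_pairing hA) s1 /(smooth_fun_pairing hA) s2.
have oTA := @cotangent_range_open _ _ _ _ hA.
have z1 := smooth_funZ oTA w.1 s1; have z2 := smooth_funZ oTA w.2 s2.
have sc : smooth_fun TA (fun=> nu / 2 * (w.1 ^+ 2 + w.2 ^+ 2)) by exact: smooth_fun_cst.
have d F := @diff_fun_smooth _ _ _ _ hA F lam.
rewrite (differentialD (d _ (smooth_funD oTA z1 z2)) (d _ sc)).
rewrite (differentialD (d _ z1) (d _ z2)).
rewrite (differentialZ w.1 (d _ s1)) (differentialZ w.2 (d _ s2)).
rewrite [X in _ + X](_ : _ = 0) ?addr0//.
by apply/rowP => l; rewrite !mxE; exact: derive_cst.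
Qed.

Lemma extremal_is_derive (X1 X2 X : M -> 'rV[R]_n) w nu lam t :
  smooth_entries A X1 -> smooth_entries A X2 -> smooth_entries A X ->
  velocity TA lam t (hamiltonian_field A (control_hamiltonian X1 X2 w nu) (lam t)) ->
  is_derive (t : R^o) 1 (pairing X \o lam : _ -> R^o)
    (w.1 * omega (differential TA (pairing X1) (lam t)) (differential TA (pairing X) (lam t))
     + w.2 * omega (differential TA (pairing X2) (lam t)) (differential TA (pairing X) (lam t))).
Proof.
move=> s1 s2 s /(is_derive_along_curve hA (smooth_fun_pairing hA s)).
rewrite -!omegaZl -omegaDl -(differential_control_hamiltonian w nu (lam t) s1 s2).
by [].
Qed.

Lemma abnormal_maximality (X1 X2 : M -> 'rV[R]_n) w lam :
  (forall v, control_hamiltonian X1 X2 v 0 lam <= control_hamiltonian X1 X2 w 0 lam) ->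
  pairing X1 lam = 0 /\ pairing X2 lam = 0.
Proof.
(* Moving the control by the gradient of a linear function raises it by the squared norm of that
   gradient, which maximality makes nonpositive. *)
move=> /(_ (w.1 + pairing X1 lam, w.2 + pairing X2 lam)).
rewrite /control_hamiltonian/=; move: (pairing X1 lam) (pairing X2 lam) => x y H.
by apply: sum_sqr_le0; lra.
Qed.

Lemma normal_maximality (X1 X2 : M -> 'rV[R]_n) w nu lam : nu < 0 ->
  (forall v, control_hamiltonian X1 X2 v nu lam <= control_hamiltonian X1 X2 w nu lam) ->
  pairing X1 lam = - nu * w.1 /\ pairing X2 lam = - nu * w.2.
Proof.
(* The test control is the maximizer of the concave quadratic, and the gain over [w] is the squared
   gradient at [w] divided by [- 2 * nu]. *)
move=> nu0 /(_ (w.1 - (pairing X1 lam + nu * w.1) / nu,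
  w.2 - (pairing X2 lam + nu * w.2) / nu)).
rewrite /control_hamiltonian/=.
move: (pairing X1 lam) (pairing X2 lam) w.1 w.2 => x y u1 u2.
set g1 := x + nu * u1; set g2 := y + nu * u2 => H.
have nu_neq0 : nu != 0 by rewrite lt_eqF.
have : - (2 * nu)^-1 * (g1 ^+ 2 + g2 ^+ 2) <= 0.
  rewrite -subr_le0 in H; rewrite (le_trans _ H)// le_eqVlt; apply/orP; left; apply/eqP.
  by rewrite /g1 /g2; field.
rewrite pmulr_rle0; last by rewrite oppr_gt0 invr_lt0 pmulr_rlt0.
move=> /sum_sqr_le0[e1 e2].
by split; [rewrite -[LHS](addrK (nu * u1))|rewrite -[LHS](addrK (nu * u2))];
  rewrite -/g1 -/g2 ?e1 ?e2 sub0r mulNr.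
Qed.

End Extremals.

Lemma velocity_unique (R : realType) (m : nat) (P : Type) (A : atlas R m P)
    (gam : R -> P) t v w : velocity A gam t v -> velocity A gam t w -> v = w.
Proof.
move=> [_ dv] [_ dw].
by rewrite -(@derive_val _ _ _ _ _ _ _ dv) -(@derive_val _ _ _ _ _ _ _ dw).
Qed.

(** * Abnormal geodesics of the Engel structure *)

Section Abnormal.
Context {R : realType} {T3 T4 T6 : R} {G : lieGroup R 4} {X1 X2 X3 X4 : G -> 'rV[R]_4}.
Local Notation A := (lie_atlas G).
Local Notation TA := (cotangent_atlas (lie_atlas G)).
Hypothesis basisX : lie_basis [tuple X1; X2; X3; X4].
Hypothesis X12 : field_bracket A X1 X2 = X3.
Hypothesis X13 : field_bracket A X1 X3 = X4.
Hypothesis X14 : field_bracket A X1 X4 = T3 *: X3.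
Hypothesis X23 : field_bracket A X2 X3 = T6 *: X1 + T4 *: X2.
Hypothesis X24 : field_bracket A X2 X4 = T4 *: X3.
Hypothesis X34 : field_bracket A X3 X4 =
  - (T6 * T3) *: X1 - (T4 * T3) *: X2 + T4 *: X4.

Let hA : is_manifold A := lie_manifold (lie_groupP G).
Implicit Types (a b t : R) (q : R -> G) (u : R -> R * R) (lam : R -> cotangent R 4 G).

Local Notation h1 := (pairing X1).
Local Notation h2 := (pairing X2).
Local Notation h3 := (pairing X3).
Local Notation h4 := (pairing X4).

(** A curve has one velocity, and [X1], [X2] are independent at each point. *)
Lemma admissible_control_unique a b q u v :
  admissible A X1 X2 a b q u -> admissible A X1 X2 a b q v ->
  ae_on a b (fun t => u t = v t).
Proof.
move=> [_ _ _ _ /ae_on_cc du] [_ _ _ _ /ae_on_cc dv].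
apply: ae_onS (ae_onI du dv) => t _ [] /velocity_unique/[apply] E.
have [] := frame_free basisX (q := q t) (a1 := (u t).1 - (v t).1)
  (a2 := (u t).2 - (v t).2) (a3 := 0) (a4 := 0).
  by rewrite !scale0r !addr0 !scalerBl addrACA E -opprD subrr.
move=> /eqP; rewrite subr_eq0 => /eqP E1 /eqP; rewrite subr_eq0 => /eqP E2 _ _.
by rewrite (surjective_pairing (u t)) E1 E2 -surjective_pairing.
Qed.

Let smooth_h j : smooth_entries A (tnth [tuple X1; X2; X3; X4] j).
Proof. by have [LX _ _] := basisX; exact: left_invariant_smooth. Qed.
Let s1 : smooth_entries A X1 := smooth_h (@Ordinal 4 0 isT).
Let s2 : smooth_entries A X2 := smooth_h (@Ordinal 4 1 isT).
Let s3 : smooth_entries A X3 := smooth_h (@Ordinal 4 2 isT).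

Lemma extremal_equations w nu lam t :
  velocity TA lam t (hamiltonian_field A (control_hamiltonian X1 X2 w nu) (lam t)) ->
  [/\ is_derive (t : R^o) 1 (h1 \o lam : _ -> R^o) (- w.2 * h3 (lam t)),
      is_derive (t : R^o) 1 (h2 \o lam : _ -> R^o) (w.1 * h3 (lam t)) &
      is_derive (t : R^o) 1 (h3 \o lam : _ -> R^o)
        (w.1 * h4 (lam t) + w.2 * (T6 * h1 (lam t) + T4 * h2 (lam t)))].
Proof.
move=> vel; have [w12 w13 _ w23 _] := omega_frame basisX X12 X13 X14 X23 X24 X34 (lam t).
have e1 := extremal_is_derive hA s1 s2 s1 vel.
have e2 := extremal_is_derive hA s1 s2 s2 vel.
have e3 := extremal_is_derive hA s1 s2 s3 vel.
rewrite omega_self omegaC w12 mulr0 add0r mulrN -mulNr in e1.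
rewrite omega_self w12 mulr0 addr0 in e2.
by rewrite w13 w23 in e3.
Qed.

Lemma speed_gt0_neq0 u t (c : R) : 0 < c -> speed u t = c -> u t <> (0, 0).
Proof.
by move=> c0 uc ut; move: c0; rewrite -uc /speed ut/= expr0n/= addr0 sqrtr0 ltxx.
Qed.

Lemma abnormal_strictly_abnormal a b q : T4 != 0 ->
  abnormal_geodesic A X1 X2 a b q -> strictly_abnormal_geodesic A X1 X2 a b q.
Proof.
move=> T40 geo; split=> // -[u' [lam' [nu [adm' nu0 pmp']]]].
have [[[u0 [adm0 [c c0 /ae_on_cc speed0]]] _] [u [lam [adm pmp]]]] := geo.
have ab : a < b by have [] := adm0.
have [_ lip nz /ae_on_cc vel /ae_on_cc maxi] := pmp.
have [_ lip' _ /ae_on_cc vel' /ae_on_cc maxi'] := pmp'.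
(* Three controls occur: [u0] has constant speed, [u] belongs to the abnormal extremal and [u'] to
   the normal one. All are transferred to [u]. *)
have uu' : ae_on a b (fun t => u t = u' t) by exact: admissible_control_unique adm adm'.
have u_neq0 : ae_on a b (fun t => u t <> (0, 0)).
  apply: ae_onS (ae_onI (admissible_control_unique adm adm0) speed0) => t _ [-> sp].
  exact: speed_gt0_neq0 c0 sp.
have cont X gam t : smooth_entries A X -> lipschitz_curve TA a b gam ->
    t \in `]a, b[ -> {for t, continuous (pairing X \o gam)}.
  by move=> sX; exact: (lipschitz_curve_continuous hA (smooth_fun_pairing hA sX)).
have h12 : ae_on a b (fun t => h1 (lam t) = 0 /\ h2 (lam t) = 0).
  by apply: ae_onS maxi => t _; exact: abnormal_maximality.
have h1_eq0 t : t \in `]a, b[ -> h1 (lam t) = 0.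
  apply: (@ae_on_continuous_eq0 _ a b (h1 \o lam)); first by move=> s; exact: cont.
  by apply: ae_onS h12 => s _ [].
have h2_eq0 t : t \in `]a, b[ -> h2 (lam t) = 0.
  apply: (@ae_on_continuous_eq0 _ a b (h2 \o lam)); first by move=> s; exact: cont.
  by apply: ae_onS h12 => s _ [].
have h3_eq0 t : t \in `]a, b[ -> h3 (lam t) = 0.
  apply: (@ae_on_continuous_eq0 _ a b (h3 \o lam)); first by move=> s; exact: cont.
  (* Differentiating h1 = 0 and h2 = 0 makes both components of the control times h3 vanish, and the
     control is nonzero. *)
  apply: ae_onS (ae_onI u_neq0 vel) => s sab [us /extremal_equations[d1 d2 _]].
  have /eqP := derive_eq0_on h1_eq0 sab d1; have /eqP := derive_eq0_on h2_eq0 sab d2.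
  rewrite !mulf_eq0 oppr_eq0 /= => /orP[/eqP e1|/eqP//] /orP[/eqP e2|/eqP//].
  by exfalso; apply: us; rewrite (surjective_pairing (u s)) e1 e2.
have u1_eq0 : ae_on a b (fun t => (u t).1 = 0 /\ (u t).2 != 0).
  apply: ae_onS (ae_onI u_neq0 vel) => t tab [ut /extremal_equations[_ _ d3]].
  have := derive_eq0_on h3_eq0 tab d3.
  rewrite h1_eq0// h2_eq0// !mulr0 addr0 mulr0 addr0 => /eqP; rewrite mulf_eq0.
  (* For an abnormal extremal nontriviality means a nonzero covector, and its three other components
     already vanish. *)
  have h4_neq0 : h4 (lam t) != 0.
    apply/eqP => h40; have [_ []] := nz t (subset_itv_oo_cc tab); last by rewrite eqxx.
    move=> /eqP; apply; apply: (covector_eq0 basisX) => //.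
    - exact: h1_eq0.
    - exact: h2_eq0.
    - exact: h3_eq0.
  rewrite (negbTE h4_neq0) orbF => /eqP u1; split=> //; apply/eqP => u2.
  by apply: ut; rewrite (surjective_pairing (u t)) u1 u2.
have {}vel' : ae_on a b (fun t =>
    [/\ h1 (lam' t) = 0, h2 (lam' t) = - nu * (u t).2, (u t).1 = 0, (u t).2 != 0 &
      velocity TA lam' t (hamiltonian_field A (control_hamiltonian X1 X2 (u t) nu) (lam' t))]).
  apply: ae_onS (ae_onI (ae_onI maxi' vel') (ae_onI uu' u1_eq0)) => t tab [[mx vl] [E [e1 e2]]].
  have [] := normal_maximality nu0 mx; rewrite -E e1 mulr0 => -> ->; split=> //.
  by rewrite E.
have k1_eq0 t : t \in `]a, b[ -> h1 (lam' t) = 0.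
  apply: (@ae_on_continuous_eq0 _ a b (h1 \o lam')); first by move=> s; exact: cont.
  by apply: ae_onS vel' => s _ [].
have k3_eq0 t : t \in `]a, b[ -> h3 (lam' t) = 0.
  apply: (@ae_on_continuous_eq0 _ a b (h3 \o lam')); first by move=> s; exact: cont.
  apply: ae_onS vel' => s sab [_ _ _ e2 /extremal_equations[d1 _ _]].
  have /eqP := derive_eq0_on k1_eq0 sab d1.
  by rewrite mulf_eq0 oppr_eq0 (negbTE e2) => /eqP.
(* One instant suffices: there the derivative of h3 along [lam'] is [- nu * T4 * (u t).2 ^+ 2], a
   nonzero number, while h3 is identically zero. *)
have [t tab [k1 k2 e1 e2 /extremal_equations[_ _ d3]]] := ae_on_witness ab vel'.
have /eqP := derive_eq0_on k3_eq0 tab d3.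
rewrite e1 k1 k2 mul0r mulr0 !add0r !mulf_eq0 oppr_eq0 (negbTE T40) (negbTE e2).
by rewrite lt_eqF.
Qed.

End Abnormal.

Theorem theorem5 (R : realType) (T3 T4 T6 : R) (G : lieGroup R 4)
    (X1 X2 X3 X4 : G -> 'rV[R]_4) :
  lie_basis [tuple X1; X2; X3; X4] ->
  field_bracket (lie_atlas G) X1 X2 = X3 ->
  field_bracket (lie_atlas G) X1 X3 = X4 ->
  field_bracket (lie_atlas G) X1 X4 = T3 *: X3 ->
  field_bracket (lie_atlas G) X2 X3 = T6 *: X1 + T4 *: X2 ->
  field_bracket (lie_atlas G) X2 X4 = T4 *: X3 ->
  field_bracket (lie_atlas G) X3 X4 =
    - (T6 * T3) *: X1 - (T4 * T3) *: X2 + T4 *: X4 ->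
  super_integrable (lie_atlas G) (normal_hamiltonian X1 X2) /\
  (T4 != 0 ->
   forall (a b : R) (q : R -> G),
     abnormal_geodesic (lie_atlas G) X1 X2 a b q ->
     strictly_abnormal_geodesic (lie_atlas G) X1 X2 a b q).
Proof.
move=> basisX X12 X13 X14 X23 X24 X34; split.
  exact: (super_integrable_normal_hamiltonian basisX X12 X13 X14 X23 X24 X34).
by move=> T40 a b q; exact: (abnormal_strictly_abnormal basisX X12 X13 X14 X23 X24 X34).
Qed.
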